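(* Let $X$ be a Gromov product space whose Gromov product boundary $\partial_PX$ has at least four points. Then $X$ is maximal if and only if the visual embedding $i_X:X\to\mathcal{M}(\partial_PX)$, $x\mapsto\rho_x$, is an isometry (distance-preserving bijection).
   Context: Antipodal spaces and Moebius spaces. Let $Z$ be a compact metrizable space containing at least four points. A separating function on $Z$ is a continuous function $\rho : Z\times Z\to[0,\infty)$ which is symmetric and satisfies $\rho(\xi,\eta)=0$ if and only if $\xi=\eta$. Its cross-ratio is defined on quadruples of distinct points of $Z$ by $[\xi,\xi',\eta,\eta']_\rho=\frac{\rho(\xi,\eta)\rho(\xi',\eta')}{\rho(\xi,\eta')\rho(\xi',\eta)}$. Two separating functions are Moebius equivalent if their cross-ratios agree. If $\rho_1,\rho_2$ are Moebius equivalent, there is a unique positive continuous function $\frac{d\rho_2}{d\rho_1}:Z\to(0,\infty)$, the derivative, such that $\rho_2(\xi,\eta)^2=\frac{d\rho_2}{d\rho_1}(\xi)\frac{d\rho_2}{d\rho_1}(\eta)\rho_1(\xi,\eta)^2$ for all $\xi,\eta\in Z$. An antipodal function on $Z$ is a separating function $\rho$ such that $\sup_{\xi,\eta}\rho(\xi,\eta)=1$ and for every $\xi\in Z$ there is $\eta\in Z$ with $\rho(\xi,\eta)=1$. An antipodal space $(Z,\rho_0)$ is such a space $Z$ equipped with an antipodal function $\rho_0$. Its Moebius space $\mathcal{M}(Z)=\mathcal{M}(Z,\rho_0)$ is the set of all antipodal functions on $Z$ Moebius equivalent to $\rho_0$, with the metric $d_{\mathcal{M}}(\rho_1,\rho_2)=\left\|\log\frac{d\rho_2}{d\rho_1}\right\|_\infty$.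 A map between antipodal spaces is Moebius if it preserves cross-ratios of all quadruples of distinct points. Gromov product spaces. A metric space is proper if closed balls are compact, and geodesically complete if every geodesic segment extends to a bi-infinite geodesic. $(y|z)_x=\frac12(d(x,y)+d(x,z)-d(y,z))$. A proper, geodesic, geodesically complete metric space $X$ is a Gromov product space if there is a second countable Hausdorff compactification $\widehat X$ of $X$ such that for every $x\in X$ the Gromov product $(\cdot|\cdot)_x:X\times X\to[0,+\infty)$ extends to a continuous function $\widehat X\times\widehat X\to[0,+\infty]$ such that for $\xi,\eta\in\widehat X\setminus X$, $(\xi|\eta)_x=+\infty$ if and only if $\xi=\eta$. Such a compactification is unique up to equivalence; it is denoted $\widehat X^P$, and $\partial_PX:=\widehat X^P\setminus X$ is the Gromov product boundary. For $x\in X$ set $\rho_x=e^{-(\cdot|\cdot)_x}$ on $\partial_PX\times\partial_PX$. When $\partial_PX$ has at least four points, the $\rho_x$ are antipodal functions on $\partial_PX$, all Moebius equivalent; $\partial_PX$ is regarded as an antipodal space with any of them, and $\mathcal{M}(\partial_PX)=\mathcal{M}(\partial_PX,\rho_x)$ does not depend on $x$. A Gromov product space $X$ is maximal if for every Gromov product space $Y$ and Moebius homeomorphism $f:\partial_PY\to\partial_PX$, there is an isometric (distance-preserving) embedding $F:Y\to X$ extending $f$, i.e. such that $F\cup f:\widehat Y^P\to\widehat X^P$ is continuous. *)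

(* Defs.v *)
From HB Require Import structures.
From mathcomp Require Import all_boot all_order all_algebra.
From mathcomp Require Import all_classical all_reals all_analysis.

Set Implicit Arguments.
Unset Strict Implicit.
Unset Printing Implicit Defensive.

Import Order.TTheory GRing.Theory Num.Theory.
Import numFieldNormedType.Exports.

Local Open Scope classical_set_scope.
Local Open Scope ring_scope.

(* Throughout, a function of two points of Z is a function on Z * Z, so that
   [continuous] refers to the product topology. *)

Section Moebius.
Context {R : realType}.

Definition has_four_points (Z : topologicalType) : Prop :=
  exists a b c d : Z, uniq [:: a; b; c; d].

Section OneSpace.
Context {Z : topologicalType}.
Implicit Types rho : Z * Z -> R.

Definition separating rho : Prop :=
  [/\ continuous rho,
      (forall xi eta, 0 <= rho (xi, eta)),
      (forall xi eta, rho (xi, eta) = rho (eta, xi)) &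
      (forall xi eta, rho (xi, eta) = 0 <-> xi = eta)].

(* [xi, xi', eta, eta']_rho *)
Definition cross_ratio rho (xi xi' eta eta' : Z) : R :=
  (rho (xi, eta) * rho (xi', eta')) / (rho (xi, eta') * rho (xi', eta)).

Definition moebius_equiv rho1 rho2 : Prop :=
  forall a b c d : Z, uniq [:: a; b; c; d] ->
    cross_ratio rho1 a b c d = cross_ratio rho2 a b c d.

Definition is_moebius_derivative rho1 rho2 (D : Z -> R) : Prop :=
  [/\ continuous D,
      (forall xi, 0 < D xi) &
      (forall xi eta, rho2 (xi, eta) ^+ 2 =
                      D xi * D eta * rho1 (xi, eta) ^+ 2)].

(* d rho2 / d rho1; the default value is irrelevant, since the derivative of
   Moebius equivalent separating functions exists and is unique. *)
Definition moebius_derivative rho1 rho2 : Z -> R :=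
  xget (fun=> 1) [set D | is_moebius_derivative rho1 rho2 D].

Definition antipodal rho : Prop :=
  [/\ separating rho,
      sup (range rho) = 1 &
      (forall xi, exists eta, rho (xi, eta) = 1)].

Definition moebius_space (rho0 : Z * Z -> R) : set (Z * Z -> R) :=
  [set rho | antipodal rho /\ moebius_equiv rho0 rho].

Definition moebius_dist rho1 rho2 : R :=
  sup (range (fun xi => `|ln (moebius_derivative rho1 rho2 xi)|)).

End OneSpace.

Definition moebius_map {Z1 Z2 : topologicalType}
    (rho1 : Z1 * Z1 -> R) (rho2 : Z2 * Z2 -> R) (f : Z1 -> Z2) : Prop :=
  forall a b c d : Z1, uniq [:: a; b; c; d] ->
    cross_ratio rho2 (f a) (f b) (f c) (f d) = cross_ratio rho1 a b c d.

End Moebius.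

Definition homeomorphism {S T : topologicalType} (f : S -> T) : Prop :=
  continuous f /\
  exists g : T -> S, [/\ continuous g, cancel f g & cancel g f].

Definition topological_embedding {S T : topologicalType} (f : S -> T) : Prop :=
  [/\ injective f, continuous f &
      (forall U : set S, open U -> exists2 V : set T, open V & U = f @^-1` V)].

Section Metric.
Context {R : realType}.

Section OneMetric.
Variable X : metricType R.

(* The library's [closed_ball] is the closure of the open ball, which may be
   smaller than the set of points at distance at most r. *)
Definition proper_space : Prop :=
  forall (x : X) (r : R), compact [set y : X | mdist x y <= r].

Definition geodesic_on (A : set R) (g : R -> X) : Prop :=
  forall s t, A s -> A t -> mdist (g s) (g t) = `|s - t|.

Definition geodesic_space : Prop :=
  forall x y : X, exists g : R -> X,
    [/\ geodesic_on `[0, mdist x y] g, g 0 = x & g (mdist x y) = y].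

Definition geodesically_complete : Prop :=
  forall (a b : R) (g : R -> X), a < b -> geodesic_on `[a, b] g ->
    exists2 gamma : R -> X, geodesic_on [set: R] gamma &
      (forall t, `[a, b]%classic t -> gamma t = g t).

(* (y|z)_x *)
Definition gromov_product (x y z : X) : R :=
  (mdist x y + mdist x z - mdist y z) / 2.

End OneMetric.

Definition distance_preserving {X Y : metricType R} (F : X -> Y) : Prop :=
  forall x y, mdist (F x) (F y) = mdist x y.

(* A compactification as in the definition of a Gromov product space. The
   extension [gpc_prod x] of (.|.)_x is determined by the other fields,
   because the image of X is dense and \bar R is Hausdorff. *)
Record gp_compactification (X : metricType R) := GPCompactification {
  gpc_space :> topologicalType;
  gpc_incl : X -> gpc_space;
  gpc_prod : X -> gpc_space * gpc_space -> \bar R;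
  gpc_compact : compact [set: gpc_space];
  gpc_hausdorff : hausdorff_space gpc_space;
  gpc_second_countable : @second_countable gpc_space;
  gpc_incl_embedding : topological_embedding gpc_incl;
  gpc_incl_dense : dense (range gpc_incl);
  gpc_prod_continuous : forall x, continuous (gpc_prod x);
  gpc_prod_ge0 : forall x p, (0 <= gpc_prod x p)%E;
  gpc_prodE : forall x y z,
    gpc_prod x (gpc_incl y, gpc_incl z) = (gromov_product x y z)%:E;
  gpc_prod_pinfty : forall x xi eta,
    (~` range gpc_incl) xi -> (~` range gpc_incl) eta ->
    (gpc_prod x (xi, eta) = +oo%E <-> xi = eta)
}.

End Metric.

(* The compactification is unique up to equivalence, so carrying one as a
   component amounts to requiring that one exists. *)
Record gromovProductSpace (R : realType) := GromovProductSpace {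
  gp_sort :> metricType R;
  gp_proper : proper_space gp_sort;
  gp_geodesic : geodesic_space gp_sort;
  gp_complete : geodesically_complete gp_sort;
  gp_hat : gp_compactification gp_sort
}.

Section GromovProductSpaces.
Context {R : realType}.
Implicit Types X Y : gromovProductSpace R.

(* The set of boundary points; as a type it carries the topology induced by
   the compactification. *)
Definition gp_boundary X : set (gp_hat X) := ~` range (@gpc_incl _ _ (gp_hat X)).
Arguments gp_boundary X : clear implicits.

(* x |-> rho_x; here e^(-oo) = 0. *)
Definition visual X (x : X) : gp_boundary X * gp_boundary X -> R :=
  fun p => fine (expeR (- gpc_prod x (set_val p.1, set_val p.2))).

(* M(boundary of X): all the rho_x are Moebius equivalent, so that the sets
   [moebius_space (visual x)] all coincide. *)
Definition boundary_moebius_space X :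
    set (gp_boundary X * gp_boundary X -> R) :=
  \bigcup_(x in [set: X]) moebius_space (visual x).
Arguments boundary_moebius_space X : clear implicits.

Definition visual_isometry X : Prop :=
  set_bij [set: X] (boundary_moebius_space X) (@visual X) /\
  (forall x y : X, moebius_dist (visual x) (visual y) = mdist x y).

(* The map Fhat below is the union of F and f. *)
Definition extends_continuously Y X (F : Y -> X)
    (f : gp_boundary Y -> gp_boundary X) : Prop :=
  exists Fhat : gp_hat Y -> gp_hat X,
    [/\ continuous Fhat,
        (forall y, Fhat (gpc_incl (gp_hat Y) y) = gpc_incl (gp_hat X) (F y)) &
        (forall xi : gp_boundary Y, Fhat (set_val xi) = set_val (f xi))].

(* Whether f is Moebius does not depend on the chosen y and x. *)
Definition maximal X : Prop :=
  forall Y (f : gp_boundary Y -> gp_boundary X),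
    homeomorphism f ->
    (forall (y : Y) (x : X), moebius_map (visual y) (visual x) f) ->
    exists2 F : Y -> X, distance_preserving F & extends_continuously F f.

End GromovProductSpaces.

Arguments gp_boundary {R} X.
Arguments boundary_moebius_space {R} X.
Arguments visual_isometry {R} X.
Arguments maximal {R} X.

(* Main.v *)
Require Import Defs.
From HB Require Import structures.
From mathcomp Require Import all_boot all_order all_algebra.
From mathcomp Require Import all_classical all_reals all_analysis.
From mathcomp Require Import ring lra.

(** Every Gromov product space X embeds isometrically in the Moebius space of
    its boundary: by geodesic completeness each rho_x is antipodal
    ([visual_antipodal]), the derivative of rho_x' with respect to rho_x is the
    exponential of a Busemann function, and some geodesic ray from x through x'
    makes that Busemann function reach d(x, x') ([moebius_dist_visual]).  The
    theorem is therefore about surjectivity of x |-> rho_x.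

    If x |-> rho_x is onto, a Moebius homeomorphism f from the boundary of Y
    to that of X pushes rho_y forward to some rho_x, and F y := x is the
    required embedding.  Distances and all Gromov products between points of
    the compactifications can be read off from the functions rho_y, so F
    together with f preserves Gromov products; that alone makes it continuous
    ([product_preserving_continuous]), because a Gromov product with a
    suitable point separates a given point of a compact space from the others.

    If X is maximal, fix x0 and rho0 := rho_x0.  The point is that the Moebius
    space of an antipodal space (Z, rho0) is itself a Gromov product space with
    boundary Z, in which the visual function of a point rho is rho.  Applying
    maximality to it and to the identity of the boundary gives F, and comparing
    Gromov products at infinity gives rho_(F rho) = rho: surjectivity.

    To build that Gromov product space, write a function Moebius equivalent to
    rho0 as exp(-(f xi + f eta)/2) rho0(xi, eta).  With L := 2 ln rho0 it is
    antipodal iff f xi = sup over eta <> xi of L(xi, eta) - f eta, so that the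
    Moebius space is the tight span of Z with the sup distance, L taking the
    place of a metric on Z and its diagonal being discarded.
    As for the tight span of a metric space, there is a 1-Lipschitz retraction
    onto it ([retract_extremal], [retract_lip]).  It turns straight segments
    into geodesics ([mp_geodesic]) and the functions f - t at xi, f + t
    elsewhere into geodesic rays to xi, which extend geodesics
    ([mp_geodesically_complete]); these functions need not be continuous, since
    extremality forces continuity ([extremal_continuous]).  The same
    equicontinuity gives properness ([mp_proper]).

    For the compactification, the normalised function exp((f - |f|)/2), where
    |f| is the sup norm, is the supremum of the functions c(eta) rho0(eta, .),
    with 0 < c <= 1, and tends to rho0(xi, .) when f goes to xi.
    The sup distance between these functions,
    indexed by the Moebius space and Z together, is a compact metric
    ([hat_compact]) for which exp(-(.|.)) is Lipschitz ([hat_prod_lip]). *)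

Set Implicit Arguments.
Unset Strict Implicit.
Unset Printing Implicit Defensive.

Import Order.TTheory GRing.Theory Num.Theory.
Import numFieldNormedType.Exports.

Local Open Scope classical_set_scope.
Local Open Scope ring_scope.

(** * Compactness, density and continuity *)

Section Compactness.

Lemma compact_argmax (R : realType) (T : topologicalType) (t0 : T) (g : T -> R) :
  compact [set: T] -> continuous g -> exists t, forall u, g u <= g t.
Proof.
move=> cT cg; have [||c _ H] := @compact_EVT_max T R g setT _ cT; first by exists t0.
- exact: (continuous_subspaceT cg).
- by exists c => u; rewrite H ?inE.
Qed.

(** Outside a neighbourhood of [t0] the values of [phi] form a closed set that
    misses [phi t0]; so convergence in a compact space can be tested on a single
    function that separates the limit from all other points. *)
Lemma cvg_of_separated (T U : topologicalType) (phi : T -> U) (t0 : T)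
    (F : set_system T) : Filter F -> compact [set: T] -> hausdorff_space U ->
  continuous phi -> (forall t, phi t = phi t0 -> t = t0) ->
  phi @ F --> phi t0 -> F --> t0.
Proof.
move=> FF cT hU cphi sep Fphi A; rewrite nbhsE => -[V [oV Vt0] VA].
have cV : compact (phi @` ~` V).
  apply: continuous_compact; first exact: (continuous_subspaceT cphi).
  by apply: (subclosed_compact _ cT) => //; exact: open_closedC.
have : nbhs (phi t0) (~` (phi @` ~` V)).
  apply: open_nbhs_nbhs; split; first by apply: closed_openC; apply: compact_closed.
  by case=> t Vt /sep tt0; apply: Vt; rewrite tt0.
move=> /Fphi FV; apply: (@filterS _ F FF _ _ _ FV) => t /= Vt; apply: VA.
by apply: contrapT => nVt; apply: Vt; exists t.
Qed.

Lemma continuous_pair (T U V : topologicalType) (f : T -> U) (g : T -> V) :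
  continuous f -> continuous g -> continuous (fun t => (f t, g t)).
Proof. by move=> cf cg t; apply: cvg_pair; [exact: cf|exact: cg]. Qed.

Lemma continuous_compose (T U V : topologicalType) (f : T -> U) (g : U -> V) :
  continuous f -> continuous g -> continuous (fun t => g (f t)).
Proof. by move=> cf cg t; apply: continuous_comp; [exact: cf|exact: cg]. Qed.

Lemma continuous_fst (T U : topologicalType) : continuous (@fst T U).
Proof. by move=> ?; exact: cvg_fst. Qed.

Lemma continuous_snd (T U : topologicalType) : continuous (@snd T U).
Proof. by move=> ?; exact: cvg_snd. Qed.

Lemma continuous_section (T U V : topologicalType) (f : T * U -> V) (t : T) :
  continuous f -> continuous (fun u => f (t, u)).
Proof.
move=> cf u; apply: (@continuous_comp _ _ _ (fun u => (t, u)) f); last exact: cf.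
by apply: cvg_pair; [exact: cvg_cst|exact: cvg_id].
Qed.

Lemma dense_closed (T : topologicalType) (D C : set T) :
  dense D -> closed C -> D `<=` C -> forall t, C t.
Proof.
move=> dD cC DC t; apply: contrapT => Ct.
have [u [Cu Du]] := dD (~` C) (ex_intro _ t Ct) (closed_openC cC).
exact/Cu/DC.
Qed.

Lemma dense_pair_eq (S T U : topologicalType) (i : S -> T) (f g : T * T -> U) :
  hausdorff_space U -> dense (range i) -> continuous f -> continuous g ->
  (forall s t, f (i s, i t) = g (i s, i t)) -> f = g.
Proof.
move=> hU di cf cg fg; apply: funext => p; apply: hU => A B nA nB.
have : nbhs p (f @^-1` A `&` g @^-1` B) by apply: filterI; [exact: cf|exact: cg].
move=> [[/= C D] [nC nD] CD].
move: nC nD; rewrite !nbhsE => -[C' [oC' C'p] C'C] [D' [oD' D'p] D'D].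
have [u [C'u [s _ su]]] := di C' (ex_intro _ _ C'p) oC'; subst u.
have [u [D'u [t _ tu]]] := di D' (ex_intro _ _ D'p) oD'; subst u.
have [Af Bg] := CD (i s, i t) (conj (C'C _ C'u) (D'D _ D'u)).
by exists (f (i s, i t)); split => //; rewrite fg.
Qed.

Lemma ultra_fmap (S T : Type) (f : S -> T) (F : set_system S) :
  UltraFilter F -> UltraFilter (f @ F).
Proof.
move=> UF; split=> [|G PG FG]; first exact: fmap_proper_filter.
apply/seteqP; split=> [A GA|]; last exact: FG.
have [//|FcA] := in_ultra_setVsetC (f @^-1` A) UF.
have GcA : G (~` A) by exact: FG.
by have [? []] := @filter_ex _ _ PG _ (filterI GA GcA).
Qed.

Lemma cvg_set_val (T : topologicalType) (A : set T) (F : set_system A) (x : A) :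
  Filter F -> set_val @ F --> set_val x -> F --> x.
Proof.
move=> FF Fx U; rewrite nbhsE => -[_ [[V oV <-] Vx] VU].
have : nbhs (set_val x) V by exact: open_nbhs_nbhs.
by move=> /Fx FV; exact: (@filterS _ F FF _ _ VU FV).
Qed.

Lemma set_val_continuous (T : topologicalType) (A : set T) :
  continuous (set_val : A -> T).
Proof. exact: initial_continuous. Qed.

Lemma set_type_compact (T : topologicalType) (A : set T) :
  compact A -> compact [set: A].
Proof.
rewrite !compact_ultra => cA F UF _.
have [||p [Ap Fp]] := cA (set_val @ F).
- exact: ultra_fmap.
- by apply: (@filterS _ F _ setT) => [x _|]; [exact: set_valP|exact: filterT].
exists (exist _ p (mem_set Ap)); split => //.
exact: cvg_set_val.
Qed.

End Compactness.

Section MetricContinuity.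
Context {R : realType}.

Lemma continuous_to_metric (T : topologicalType) (Y : metricType R) (F : T -> Y) :
  (forall t e, 0 < e -> \forall s \near t, mdist (F t) (F s) < e) -> continuous F.
Proof.
move=> H t; apply/cvg_ballP => e e0; apply: filterS (H t e e0) => s.
by rewrite ballEmdist.
Qed.

Lemma lip_continuous (X Y : metricType R) (F : X -> Y) :
  (forall x y, mdist (F x) (F y) <= mdist x y) -> continuous F.
Proof.
move=> lip; apply: continuous_to_metric => x e e0.
have := nbhsx_ballx x e e0; apply: filterS => y.
by rewrite ballEmdist/=; exact/le_lt_trans/lip.
Qed.

End MetricContinuity.

(** The next two lemmas pass between Gromov products, with values in [0, +oo],
    and their exponentials, which are real valued. *)
Lemma neg_lne_continuous (R : realType) (T : topologicalType) (u : T -> R) :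
  continuous u -> (forall t, 0 <= u t) ->
  continuous (fun t => (- lne (u t)%:E)%E).
Proof.
move=> cu u0 t.
suff : (fun s => (- lne (u s)%:E)%E) @ t --> (- lne (u t)%:E)%E by [].
have := u0 t; rewrite le_eqVlt => /orP[/eqP ut|ut].
  rewrite -ut le0_lneNy//.
  apply/cvgeyPge => r; have : 0 < expR (- r) by exact: expR_gt0.
  move=> /((cvgrPdist_lt _ _).1 (cu t)); apply: filterS => s.
  rewrite -ut sub0r normrN ger0_norm// => us.
  have := u0 s; rewrite le_eqVlt => /orP[/eqP <-|us0].
    by rewrite le0_lneNy//= leey.
  rewrite lne_EFin// -EFinN lee_fin lerNr.
  by rewrite -ler_expR lnK ?posrE// ltW.
have -> : (- lne (u t)%:E)%E = (- ln (u t))%:E by rewrite lne_EFin// EFinN.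
have near0 : \forall s \near t, 0 < u s.
  apply: (@filterS _ _ _ _ _ _ ((cvgrPdist_lt _ _).1 (cu t) _ ut)) => s /=.
  by rewrite ltr_norml => /andP[_]; rewrite ltrBlDr ltrDl.
apply: (@cvg_trans _ ((fun s => (- ln (u s))%:E) @ t)).
  apply: near_eq_cvg; apply: filterS near0 => s us.
  by rewrite lne_EFin// EFinN.
apply: cvg_EFin; first by near=> s.
apply: cvgN; apply: continuous_comp; first exact: cu.
exact: continuous_ln.
Unshelve. all: by end_near. Qed.

Lemma expR_neg_continuous (R : realType) (T : topologicalType) (u : T -> \bar R) :
  continuous u -> (forall t, (0 <= u t)%E) ->
  continuous (fun t => fine (expeR (- u t))).
Proof.
move=> cu u0 t; apply/cvgrPdist_lt => e e0.
have := u0 t; case ut : (u t) => [r| |]// r0.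
  have := cu t; rewrite /continuous_at ut => /fine_cvgP[fu cfu].
  have : (fun s => expR (- fine (u s))) @ t --> expR (- r).
    apply: continuous_cvg; first exact: continuous_expR.
    exact: cvgN.
  move=> /cvgrPdist_lt/(_ e e0); rewrite /= => H; near=> s.
  have fs : u s \is a fin_num by near: s.
  by rewrite -(fineK fs)/=; near: s.
have := cu t; rewrite /continuous_at ut => /cvgeyPge/(_ (1 - ln e)) H.
apply: filterS H => s us; rewrite /= sub0r normrN.
case us' : (u s) us => [x| |]//=; last by rewrite normr0.
rewrite lee_fin => ex; rewrite ger0_norm ?expR_ge0//.
by rewrite -[ltRHS](@lnK _ e) ?posrE// ltr_expR; lra.
Unshelve. all: by end_near. Qed.

Lemma expR_lip_nonpos (R : realType) (a b : R) : a <= 0 -> b <= 0 ->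
  `|expR a - expR b| <= `|a - b|.
Proof.
have H (c d : R) : c <= 0 -> expR c - expR d <= `|c - d|.
  move=> c0; have [cd|/ltW dc] := leP c d.
    by apply: (@le_trans _ _ 0) => //; rewrite subr_le0 ler_expR.
  rewrite ger0_norm ?subr_ge0//.
  have := expR_ge1Dx (d - c); rewrite expRB => h.
  have c1 : expR c <= 1 by rewrite expR_le1.
  have c2 := expR_gt0 c.
  have : expR c * (1 + (d - c)) <= expR d.
    by rewrite mulrC -ler_pdivlMr.
  nra.
move=> a0 b0; have := H a b a0; have := H b a b0; rewrite distrC.
by rewrite ler_norml => *; apply/andP; split; lra.
Qed.

(** * The tight span of a kernel *)
Section SupDistance.
Context {R : realType} {Z : Type}.
Implicit Types f g h : Z -> R.

Definition fbounded f := exists C, forall z, `|f z| <= C.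

Definition sup_dist f g : R := sup (range (fun z => `|f z - g z|)).

Lemma sup_dist_ub f g : fbounded f -> fbounded g ->
  forall z, `|f z - g z| <= sup_dist f g.
Proof.
move=> [C fC] [D gD] z; apply: sup_ubound; last by exists z.
exists (C + D) => _ [y _ <-].
by rewrite (le_trans (ler_normB _ _))// lerD.
Qed.

Lemma sup_dist_le f g (c : R) (z0 : Z) : (forall z, `|f z - g z| <= c) ->
  sup_dist f g <= c.
Proof.
move=> fgc; apply: ge_sup; first by exists `|f z0 - g z0|, z0.
by move=> _ [y _ <-].
Qed.

Lemma sup_dist_sym f g : sup_dist f g = sup_dist g f.
Proof.
by congr sup; apply/seteqP; split=> _ [y _ <-]; exists y => //; rewrite distrC.
Qed.

Lemma sup_distxx f (z0 : Z) : sup_dist f f = 0.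
Proof.
rewrite /sup_dist -[RHS]sup1; congr sup.
apply/seteqP; split=> [_ [y _ <-]|_ ->]; first by rewrite subrr normr0.
by exists z0 => //; rewrite subrr normr0.
Qed.

Lemma sup_dist_triangle f g h (z0 : Z) :
  fbounded f -> fbounded g -> fbounded h ->
  sup_dist f h <= sup_dist f g + sup_dist g h.
Proof.
move=> bf bg bh; apply: sup_dist_le => // z.
rewrite (le_trans (ler_distD (g z) _ _))// lerD ?sup_dist_ub//.
Qed.

Lemma sup_dist0 f g : fbounded f -> fbounded g ->
  sup_dist f g = 0 -> f = g.
Proof.
move=> bf bg fg0; apply: funext => z; apply/eqP.
by rewrite -subr_eq0 -normr_le0 -fg0 sup_dist_ub.
Qed.

End SupDistance.

(** [L] plays the role of the distance in the tight span of a metric space. Its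
    diagonal is left out, as if its value there were -oo; this is what makes
    geodesic rays exist in every direction (see [pull] below). *)
Section TightSpan.
Context {R : realType} {Z : choiceType} (L : Z -> Z -> R).
Hypothesis L_sym : forall x y, L x y = L y x.
Hypothesis L_le0 : forall x y, x != y -> L x y <= 0.
Hypothesis L_max : forall x, exists2 y, y != x & L x y = 0.
Implicit Types f g h : Z -> R.

(** A function is admissible iff it lies above its dual; the extremal functions
    are the minimal admissible ones. *)
Definition dual f x : R := sup [set L x y - f y | y in [set y | y != x]].

Definition extremal f := fbounded f /\ dual f = f.

Definition admissible f :=
  fbounded f /\ (forall x y, x != y -> L x y <= f x + f y).

Lemma dual_ge f x y : fbounded f -> y != x -> L x y - f y <= dual f x.
Proof.
move=> [C fC] yx; apply: sup_ubound; last by exists y.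
exists C => _ [z zx <-]; have := fC z; rewrite ler_norml => /andP[].
by have := @L_le0 x z; rewrite eq_sym zx => /(_ isT); lra.
Qed.

Lemma dual_le f x c : (forall y, y != x -> L x y - f y <= c) -> dual f x <= c.
Proof.
move=> fc; apply: ge_sup; last by move=> _ [y /= yx <-]; exact: fc.
by have [y yx _] := L_max x; exists (L x y - f y), y.
Qed.

Lemma dual_shift f g c : fbounded f -> (forall x, f x <= g x + c) ->
  forall x, dual g x <= dual f x + c.
Proof.
move=> bf fg x; apply: dual_le => y yx.
by have := dual_ge bf yx; have := fg y; lra.
Qed.

Lemma admissible_dual_le f : admissible f -> forall x, dual f x <= f x.
Proof.
move=> [bf aL] x; apply: dual_le => y yx.
by have := aL x y; rewrite eq_sym yx => /(_ isT); lra.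
Qed.

Lemma extremal_admissible f : extremal f -> admissible f.
Proof.
move=> [bf df]; split=> // x y xy.
by have := @dual_ge f x y bf; rewrite df eq_sym xy => /(_ isT); lra.
Qed.

Lemma dual_bounded_below f C : (forall z, `|f z| <= C) -> forall x, - C <= dual f x.
Proof.
move=> fC x; have [y yx Lxy] := L_max x.
have := @dual_ge f x y (ex_intro _ C fC) yx.
by have := fC y; rewrite ler_norml => /andP[]; lra.
Qed.

(** [dual] is 1-Lipschitz for the sup distance. *)
Lemma extremal_uniform_limit h :
  (forall e, 0 < e -> exists2 f, extremal f & forall z, `|f z - h z| <= e) ->
  extremal h.
Proof.
move=> lim; have bh : fbounded h.
  have [f [[C fC] _] fh] := lim 1 ltr01.
  exists (C + 1) => z; rewrite -[h z](subrK (f z)) addrC.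
  by rewrite (le_trans (ler_normD _ _))// lerD// distrC.
split=> //; apply: funext => x; apply/eqP; rewrite eq_le.
apply/andP; split; apply/ler_addgt0Pr => e e0; have e20 : 0 < e / 2 by lra.
  have [f [bf df] fh] := lim _ e20.
  have := @dual_shift f h (e / 2) bf _ x; rewrite df => H.
  have := fh x; rewrite ler_norml => /andP[_ ?].
  suff : dual h x <= f x + e / 2 by lra.
  by apply: H => y; have := fh y; rewrite ler_norml => /andP[_ ?]; lra.
have [f [bf df] fh] := lim _ e20.
have := @dual_shift h f (e / 2) bh _ x; rewrite df => H.
have := fh x; rewrite ler_norml => /andP[? _].
suff : f x <= dual h x + e / 2 by lra.
by apply: H => y; have := fh y; rewrite ler_norml => /andP[? _]; lra.
Qed.

(** Dress's construction: averaging with the dual keeps a function admissible,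
    and iterating it makes the gap between function and dual tend to 0. *)
Definition half_dual f x : R := (f x + dual f x) / 2.

Lemma half_dual_le f : admissible f -> forall x, half_dual f x <= f x.
Proof. by move=> /admissible_dual_le dl x; have := dl x; rewrite /half_dual; lra. Qed.

Lemma half_dual_bound f C : admissible f -> (forall z, `|f z| <= C) ->
  forall z, `|half_dual f z| <= C.
Proof.
move=> af fC z; have := fC z; have := dual_bounded_below fC z.
have := admissible_dual_le af z.
by rewrite !ler_norml /half_dual => ? ? /andP[? ?]; apply/andP; split; lra.
Qed.

Lemma half_dual_admissible f : admissible f -> admissible (half_dual f).
Proof.
move=> af; have [[C fC] aL] := af; split.
  by exists C; exact: half_dual_bound.
move=> x y xy; have bf : fbounded f by exists C.
have := dual_ge bf xy; have yx : y != x by rewrite eq_sym.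
by have := dual_ge bf yx; rewrite /half_dual (L_sym y x); lra.
Qed.

Lemma half_dual_lip f g c : fbounded f -> fbounded g ->
  (forall x, `|f x - g x| <= c) -> forall x, `|half_dual f x - half_dual g x| <= c.
Proof.
move=> bf bg fg x.
have h1 y : f y <= g y + c by have := fg y; rewrite ler_norml => /andP[]; lra.
have h2 y : g y <= f y + c by have := fg y; rewrite ler_norml => /andP[]; lra.
have := dual_shift bf h1 x; have := dual_shift bg h2 x.
by have := h1 x; have := h2 x; rewrite /half_dual ler_norml => *; apply/andP; split; lra.
Qed.

(** The infimum is the limit, because the iterates decrease. *)
Definition retract f x : R := inf (range (fun n => iter n half_dual f x)).

Section Retract.
Variables (f : Z -> R) (af : admissible f).

Lemma iter_admissible n : admissible (iter n half_dual f).
Proof. by elim: n => //= n; exact: half_dual_admissible. Qed.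

Lemma iter_bound n C : (forall z, `|f z| <= C) ->
  forall z, `|iter n half_dual f z| <= C.
Proof.
move=> fC; elim: n => //= n IH.
by apply: half_dual_bound => //; exact: iter_admissible.
Qed.

Lemma iter_nonincreasing m n : (m <= n)%N ->
  forall z, iter n half_dual f z <= iter m half_dual f z.
Proof.
move=> mn z; rewrite -(subnK mn); elim: (n - m)%N => //= k IH.
by rewrite (le_trans _ IH)// half_dual_le//; exact: iter_admissible.
Qed.

Lemma retract_le_iter n z : retract f z <= iter n half_dual f z.
Proof.
apply: ge_inf; last by exists n.
have [[C fC] _] := af; exists (- C) => _ [k _ <-].
by have := iter_bound k fC z; rewrite ler_norml => /andP[].
Qed.

Lemma retract_ge c z : (forall n, c <= iter n half_dual f z) -> c <= retract f z.
Proof.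
move=> cn; apply: lb_le_inf; last by move=> _ [k _ <-].
by exists (iter 0 half_dual f z), 0%N.
Qed.

Lemma retract_approx z e : 0 < e ->
  exists n, iter n half_dual f z < retract f z + e.
Proof.
move=> e0; apply: contrapT => /forallNP H.
have : retract f z + e <= retract f z.
  by apply: retract_ge => n; rewrite leNgt; apply/negP/H.
lra.
Qed.

Lemma retract_le z : retract f z <= f z.
Proof. exact: (retract_le_iter 0). Qed.

Lemma retract_bounded : fbounded (retract f).
Proof.
have [[C fC] _] := af; exists C => z; rewrite ler_norml; apply/andP; split.
  apply: retract_ge => n.
  by have := iter_bound n fC z; rewrite ler_norml => /andP[].
by rewrite (le_trans (retract_le z))//; have := fC z; rewrite ler_norml => /andP[].
Qed.

Lemma retract_admissible : admissible (retract f).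
Proof.
split; first exact: retract_bounded.
move=> x y xy; apply/ler_addgt0Pr => e e0.
have e20 : 0 < e / 2 by lra.
have [n nx] := retract_approx x e20; have [m my] := retract_approx y e20.
have := (iter_admissible (maxn n m)).2 x y xy.
have := iter_nonincreasing (leq_maxl n m) x.
have := iter_nonincreasing (leq_maxr n m) y.
lra.
Qed.

(** The gap between the [n]-th iterate and its dual is twice the [n]-th
    decrement, which is arbitrarily small for large [n]. *)
Lemma retract_extremal : extremal (retract f).
Proof.
split; first exact: retract_bounded.
apply: funext => x; apply/eqP; rewrite eq_le.
rewrite (admissible_dual_le retract_admissible)/=.
apply/ler_addgt0Pr => e e0.
have e20 : 0 < e / 2 by lra.
have [n nx] := retract_approx x e20.
have := retract_le_iter n.+1 x.
have : dual (iter n half_dual f) x <= dual (retract f) x + 0.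
  apply: dual_shift; first exact: retract_bounded.
  by move=> z; rewrite addr0 retract_le_iter.
rewrite /= {2}/half_dual.
lra.
Qed.

End Retract.

Lemma retract_id f : extremal f -> retract f = f.
Proof.
move=> [bf df]; apply: funext => z; rewrite /retract.
have hf n : iter n half_dual f = f.
  elim: n => //= n ->; apply: funext => x; rewrite /half_dual df; lra.
rewrite -[RHS]inf1; congr inf.
by apply/seteqP; split=> [_ [n _ <-]|_ ->]; [rewrite hf|exists 0%N].
Qed.

(** Inherited from [half_dual_lip] by every iterate, hence by the limit. *)
Lemma retract_lip f g c : admissible f -> admissible g ->
  (forall x, `|f x - g x| <= c) -> forall x, `|retract f x - retract g x| <= c.
Proof.
move=> af ag fg x.
have fgn n y : `|iter n half_dual f y - iter n half_dual g y| <= c.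
  elim: n y => //= n IH; apply: half_dual_lip => //.
    by have [] := iter_admissible af n.
  by have [] := iter_admissible ag n.
have {}fgn n : iter n half_dual f x <= iter n half_dual g x + c /\
    iter n half_dual g x <= iter n half_dual f x + c.
  by have := fgn n x; rewrite ler_norml => /andP[]; split; lra.
rewrite ler_norml; apply/andP; split.
  suff : retract g x - c <= retract f x by lra.
  apply: retract_ge => n; have := retract_le_iter ag n x.
  by have := (fgn n).2; lra.
suff : retract f x - c <= retract g x by lra.
apply: retract_ge => n; have := retract_le_iter af n x.
by have := (fgn n).1; lra.
Qed.

Lemma admissible_convex f g t : 0 <= t <= 1 -> admissible f -> admissible g ->
  admissible (fun z => f z + t * (g z - f z)).
Proof.
move=> /andP[t0 t1] [[C fC] aL] [[D gD] bL]; split.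
  exists (C + 1 * (D + C)) => z; rewrite (le_trans (ler_normD _ _))// lerD//.
  rewrite normrM (ger0_norm t0) ler_pM//.
  by rewrite (le_trans (ler_normB _ _))// lerD.
move=> x y xy; have := aL x y xy; have := bL x y xy.
move=> ? ?; have : 0 <= (1 - t) * (f x + f y - L x y).
  by apply: mulr_ge0; lra.
have : 0 <= t * (g x + g y - L x y) by apply: mulr_ge0; lra.
by nra.
Qed.

(** The retraction of this function is the point at time [t] on a geodesic ray
    from [f] to [x]. It is admissible because the condition at the pair
    [(x, x)], the only one where both terms decrease, is absent. *)
Definition pull f (x : Z) (t : R) : Z -> R :=
  fun z => if z == x then f x - t else f z + t.

Lemma pull_admissible f x t : 0 <= t -> admissible f -> admissible (pull f x t).
Proof.
move=> t0 [[C fC] aL]; split.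
  exists (C + t) => z; rewrite /pull; case: eqVneq => _.
    by rewrite (le_trans (ler_normB _ _))// lerD// ger0_norm.
  by rewrite (le_trans (ler_normD _ _))// lerD// ger0_norm.
move=> y z yz; have := aL y z yz; rewrite /pull.
case: eqVneq => [yx|yx]; case: eqVneq => [zx|zx].
- by rewrite yx zx eqxx in yz.
- by rewrite yx; lra.
- by rewrite zx; lra.
- lra.
Qed.

Lemma pull_lip f x s t z : `|pull f x s z - pull f x t z| <= `|s - t|.
Proof.
rewrite /pull; case: eqVneq => _.
  by rewrite opprB addrC addrA subrK distrC.
by rewrite opprD addrACA subrr add0r.
Qed.

Lemma pull0 f x : pull f x 0 = f.
Proof. by apply: funext => z; rewrite /pull; case: eqVneq => [->|_]; lra. Qed.

End TightSpan.

(** * Extremal functions on an antipodal space *)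

(** The supremum of an unbounded set is 0 by convention, so a supremum equal
    to 1 is an upper bound. *)
Lemma antipodal_le1 (R : realType) (Z : topologicalType) (rho : Z * Z -> R) p :
  antipodal rho -> rho p <= 1.
Proof.
move=> [_ s1 _]; rewrite -s1; apply: ub_le_sup; last by exists p.
have [[_ //]|/sup_out] := pselect (has_sup (range rho)).
by rewrite s1 => /eqP; rewrite oner_eq0.
Qed.

Record antipodalSpace (R : realType) := AntipodalSpace {
  as_space :> topologicalType;
  as_rho : as_space * as_space -> R;
  as_point : as_space;
  as_compact : compact [set: as_space];
  as_antipodal : antipodal as_rho
}.

Section Kernel.
Context {R : realType} (A : antipodalSpace R).
Local Notation rho := (@as_rho R A).
Implicit Types (x y z : A) (f g : A -> R).

Lemma rho_continuous : continuous rho.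
Proof. by have [[]] := as_antipodal A. Qed.

Lemma rho_ge0 x y : 0 <= rho (x, y).
Proof. by have [[]] := as_antipodal A. Qed.

Lemma rho_sym x y : rho (x, y) = rho (y, x).
Proof. by have [[]] := as_antipodal A. Qed.

Lemma rho_eq0 x y : rho (x, y) = 0 <-> x = y.
Proof. by have [[]] := as_antipodal A. Qed.

Lemma rhoxx x : rho (x, x) = 0.
Proof. exact/rho_eq0. Qed.

Lemma rho_gt0 x y : x != y -> 0 < rho (x, y).
Proof.
rewrite lt_neqAle rho_ge0 andbT => /eqP xy; apply/eqP => /esym/rho_eq0.
exact: xy.
Qed.

Lemma rho_le1 x y : rho (x, y) <= 1.
Proof. exact: antipodal_le1 (as_antipodal A). Qed.

(** The function rho_f = exp(- (f x + f y) / 2) rho (x, y) is at most 1 iff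
    f x + f y >= log_kernel x y for x <> y, hence the factor 2. *)
Definition log_kernel x y : R := 2 * ln (rho (x, y)).
Local Notation L := log_kernel.

Lemma expR_log_kernel x y : x != y -> expR (L x y / 2) = rho (x, y).
Proof.
by move=> xy; rewrite /L mulrAC divff ?mul1r ?lnK// posrE rho_gt0.
Qed.

Lemma log_kernel_sym x y : L x y = L y x.
Proof. by rewrite /L rho_sym. Qed.

Lemma log_kernel_le0 x y : x != y -> L x y <= 0.
Proof. by move=> xy; rewrite /L pmulr_rle0// ln_le0// rho_le1. Qed.

Lemma log_kernel_max x : exists2 y, y != x & L x y = 0.
Proof.
have [_ _ /(_ x)[y xy]] := as_antipodal A; exists y; last first.
  by rewrite /L xy ln1 mulr0.
by apply/eqP => yx; move: xy; rewrite yx rhoxx => /esym/eqP; rewrite oner_eq0.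
Qed.

Lemma extremal0 : extremal L (fun=> 0).
Proof.
split; first by exists 0 => z; rewrite normr0.
apply: funext => x; apply/eqP; rewrite eq_le; apply/andP; split.
  apply: (dual_le log_kernel_max) => y yx.
  by rewrite subr0 log_kernel_le0// eq_sym.
have [y yx Lxy] := log_kernel_max x.
have b0 : fbounded (fun _ : A => 0 : R) by exists 0 => z; rewrite normr0.
by have := dual_ge log_kernel_le0 b0 yx; rewrite Lxy subr0.
Qed.

Definition sup_norm f : R := sup_dist f (fun=> 0).

Lemma zero_bounded : fbounded (fun _ : A => 0 : R).
Proof. by exists 0 => z; rewrite normr0. Qed.

Lemma le_sup_norm f x : fbounded f -> `|f x| <= sup_norm f.
Proof. by move=> /sup_dist_ub/(_ zero_bounded x); rewrite subr0. Qed.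

Lemma sup_norm_dist f g : fbounded f -> fbounded g ->
  `|sup_norm f - sup_norm g| <= sup_dist f g.
Proof.
move=> bf bg; have z0 := as_point A.
have := sup_dist_triangle z0 bf bg zero_bounded.
have := sup_dist_triangle z0 bg bf zero_bounded.
rewrite -/(sup_norm f) -/(sup_norm g) (sup_dist_sym g f) ler_norml => *.
by apply/andP; split; lra.
Qed.

(** In the Moebius space with base point [0], a boundary point [x] and the point
    [f] have Gromov product (sup_norm f - f x) / 2, so [profile f x] is
    exp(-(f|x)). With the weights, extremality of [f] becomes a formula for its
    profile ([profile_ge], [profile_le]). *)
Definition profile f x : R := expR ((f x - sup_norm f) / 2).
Definition weight f x : R := expR (- (f x + sup_norm f) / 2).

Lemma profile_gt0 f x : 0 < profile f x. Proof. exact: expR_gt0. Qed.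
Lemma weight_gt0 f x : 0 < weight f x. Proof. exact: expR_gt0. Qed.

Lemma profile_le1 f x : fbounded f -> profile f x <= 1.
Proof.
move=> /le_sup_norm => /(_ x); rewrite ler_norml => /andP[_ ?].
by rewrite expR_le1; lra.
Qed.

Lemma weight_le1 f x : fbounded f -> weight f x <= 1.
Proof.
move=> /le_sup_norm => /(_ x); rewrite ler_norml => /andP[? _].
by rewrite expR_le1; lra.
Qed.

Lemma weight_rhoE f x y : x != y ->
  weight f x * rho (x, y) = expR ((L x y - f x - sup_norm f) / 2).
Proof.
by move=> xy; rewrite -expR_log_kernel// -expRD; congr expR; field.
Qed.

Lemma profile_ge f x y : extremal L f -> weight f x * rho (x, y) <= profile f y.
Proof.
move=> ef; have [->|xy] := eqVneq x y.
  by rewrite rhoxx mulr0 ltW// profile_gt0.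
rewrite weight_rhoE// ler_expR.
have [_ /(_ _ _ xy)] := extremal_admissible log_kernel_le0 ef.
lra.
Qed.

(** With [profile_ge]: [profile f y] is the supremum over [x] of
    weight f x * rho (x, y). So a modulus of continuity of [rho] is one for
    every profile, whatever [f] is. *)
Lemma profile_le f y S : extremal L f -> 0 < S ->
  (forall x, weight f x * rho (x, y) <= S) -> profile f y <= S.
Proof.
move=> [bf df] S0 fS; rewrite -[leRHS](@lnK _ S) ?posrE// ler_expR.
suff : f y <= sup_norm f + 2 * ln S by lra.
rewrite -df; apply: (dual_le log_kernel_max) => x xy; rewrite df.
have := fS x; rewrite weight_rhoE// -[leRHS](@lnK _ S) ?posrE// ler_expR.
rewrite (log_kernel_sym y x); lra.
Qed.

(** If rho (z, x) and rho (z, y) differ by at least [e], then [x <> y]; on the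
    compact set of all such triples [rho (x, y)] has a positive minimum. *)
Lemma rho_modulus (e : R) : 0 < e ->
  exists2 s : R, 0 < s &
    forall x y, rho (x, y) < s -> forall z, `|rho (z, x) - rho (z, y)| <= e.
Proof.
move=> e0; pose T := (A * A * A)%type.
pose g (t : T) := `|rho (t.2, t.1.1) - rho (t.2, t.1.2)|.
have cfst := continuous_fst; have csnd := continuous_snd.
have c11 : continuous (fun t : T => t.1.1).
    exact: (continuous_compose (cfst _ _) (cfst _ _)).
have c12 : continuous (fun t : T => t.1.2).
    exact: (continuous_compose (cfst _ _) (csnd _ _)).
have cg : continuous g.
  have c1 : continuous (fun t : T => rho (t.2, t.1.1)).
    apply: (@continuous_compose _ _ _ (fun t : T => (t.2, t.1.1)) rho).
      exact: (continuous_pair (csnd _ _) c11).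
    exact: rho_continuous.
  have c2 : continuous (fun t : T => rho (t.2, t.1.2)).
    apply: (@continuous_compose _ _ _ (fun t : T => (t.2, t.1.2)) rho).
      exact: (continuous_pair (csnd _ _) c12).
    exact: rho_continuous.
  by move=> t; apply: cvg_norm; apply: cvgB; [exact: c1|exact: c2].
have ch : continuous (fun t : T => rho t.1).
  exact: (continuous_compose (cfst _ _) rho_continuous).
pose K := [set t : T | e <= g t].
have cK : compact K.
  apply: (@subclosed_compact _ _ [set: T]) => //.
    by apply: ((continuous_closedP g).1 cg [set x | e <= x]); exact: closed_ge.
  rewrite -!setXTT; apply: compact_setX; last exact: as_compact.
  by apply: compact_setX; exact: as_compact.
have [[t0 Kt0]|K0] := pselect (K !=set0); last first.
  exists 1 => // x y _ z; rewrite leNgt; apply/negP => gt.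
  by apply: K0; exists ((x, y), z); exact: ltW.
have [||[[x y] z] /set_mem Kt H] := @compact_EVT_min T R (fun t => rho t.1) K _ cK.
- by exists t0.
- exact: (continuous_subspaceT ch).
exists (rho (x, y)).
  apply: rho_gt0; apply/eqP => xy; move: Kt; rewrite xy /K/= /g/= subrr normr0.
  by rewrite leNgt e0.
move=> x' y' xy' z'; rewrite leNgt; apply/negP => gt.
have := H ((x', y'), z'); rewrite leNgt xy' => /(_ _)/negP; apply => //.
by rewrite inE; exact: ltW.
Qed.

Lemma profile_modulus f x y e : extremal L f -> 0 < e ->
  (forall z, `|rho (z, x) - rho (z, y)| <= e) -> `|profile f x - profile f y| <= e.
Proof.
move=> ef e0 xy; have bf : fbounded f by have [] := ef.
have H u v : (forall z, `|rho (z, u) - rho (z, v)| <= e) ->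
    profile f u <= profile f v + e.
  move=> uv; apply: profile_le => //; first by have := profile_gt0 f v; lra.
  move=> z; have := profile_ge z v ef; have := uv z; rewrite ler_norml => /andP[_ h].
  have := weight_gt0 f z; have := weight_le1 z bf; nra.
have yx z : `|rho (z, y) - rho (z, x)| <= e by rewrite distrC.
by rewrite ler_norml; have := H _ _ xy; have := H _ _ yx => *; apply/andP; split; lra.
Qed.

Lemma rho_near x s : 0 < s -> \forall y \near x, rho (x, y) < s.
Proof.
move=> s0; have cx : continuous (fun y => rho (x, y)).
  exact/continuous_section/rho_continuous.
have : (fun y => rho (x, y)) @ x --> (0 : R) by rewrite -(rhoxx x); exact: cx.
move=> /cvgrPdist_lt/(_ s s0); apply: filterS => y.
by rewrite sub0r normrN ger0_norm// rho_ge0.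
Qed.

Lemma profile_continuous f : extremal L f -> continuous (profile f).
Proof.
move=> ef x; apply/cvgrPdist_le => e e0; have [s s0 H] := rho_modulus e0.
have := rho_near x s0; apply: filterS => y xy.
by apply: profile_modulus => //; exact: H.
Qed.

(** No continuity is assumed of [f]: it is [profile f] up to ln and a
    constant, and profiles are equicontinuous. *)
Lemma extremal_continuous f : extremal L f -> continuous f.
Proof.
move=> ef; have -> : f = fun x => sup_norm f + 2 * ln (profile f x).
  by apply: funext => x; rewrite expRK; field.
move=> x; apply: cvgD; first exact: cvg_cst.
apply: cvgM; first exact: cvg_cst.
apply: continuous_comp; first exact: profile_continuous.
exact/continuous_ln/profile_gt0.
Qed.

(** The supremum defining [dual f x] is a maximum: by continuity, after passing
    to exponentials so that the missing diagonal gets the value 0. *)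
Lemma extremal_attained f x : extremal L f ->
  exists2 y, y != x & f x + f y = L x y.
Proof.
move=> ef; have cf := extremal_continuous ef.
pose g y := weight f y * rho (x, y).
have cg : continuous g.
  move=> y; apply: cvgM.
    apply: continuous_comp; last exact: continuous_expR.
    apply: cvgM; last exact: cvg_cst.
    by apply: cvgN; apply: cvgD; [exact: cf|exact: cvg_cst].
  exact/continuous_section/rho_continuous.
have [y gy] := compact_argmax (as_point A) (@as_compact _ A) cg.
have g0 : 0 < g y.
  have [z zx _] := log_kernel_max x.
  by rewrite (lt_le_trans _ (gy z))// mulr_gt0 ?weight_gt0// rho_gt0// eq_sym.
have yx : y != x.
  by apply/eqP => yx; move: g0; rewrite /g yx rhoxx mulr0 ltxx.
exists y => //.
have : profile f x = g y.
  apply/eqP; rewrite eq_le /g (rho_sym x y) profile_ge// andbT.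
  by apply: profile_le => // [|z]; rewrite -?(rho_sym x) //; exact: gy.
rewrite /g (rho_sym x y) weight_rhoE// => /expR_inj; rewrite (log_kernel_sym y x); lra.
Qed.

(** If the maximum of |f - g| is reached at [x] with the wrong sign, it is
    reached with the right one at a point [y] where g x + g y = L x y. *)
Lemma sup_dist_attained f g : extremal L f -> extremal L g ->
  exists x, f x - g x = sup_dist f g.
Proof.
move=> ef eg; have [[bf _] [bg _]] := (ef, eg).
have cfg : continuous (fun x => `|f x - g x|).
  move=> x; apply: cvg_norm; apply: cvgB; exact: extremal_continuous.
have [x Hx] := compact_argmax (as_point A) (@as_compact _ A) cfg.
have dE : `|f x - g x| = sup_dist f g.
  by apply/eqP; rewrite eq_le sup_dist_ub//= sup_dist_le//; exact: as_point.
have [fg|fg] := leP 0 (f x - g x); first by exists x; rewrite -dE ger0_norm.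
move: dE; rewrite ltr0_norm// => dE.
have [y yx gxy] := extremal_attained x eg.
exists y; have xy : x != y by rewrite eq_sym.
have [_ /(_ _ _ xy) fxy] := extremal_admissible log_kernel_le0 ef.
have := sup_dist_ub bf bg y; rewrite ler_norml => /andP[_ h].
apply/eqP; rewrite eq_le h/=; lra.
Qed.

End Kernel.

(** * The Moebius space is proper, geodesic and geodesically complete *)

(** By the triangle inequality, a strict inequality on one piece would make the
    end points too close. *)
Lemma geodesic_on_of_lip (R : realType) (X : metricType R) (g : R -> X) (D : R) :
  (forall s t, 0 <= s -> s <= t -> t <= D -> mdist (g s) (g t) <= t - s) ->
  D <= mdist (g 0) (g D) -> geodesic_on `[0, D] g.
Proof.
move=> lip gD; suff H s t : 0 <= s -> s <= t -> t <= D -> mdist (g s) (g t) = t - s.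
  move=> s t /= ; rewrite !in_itv/= => /andP[s0 sD] /andP[t0 tD].
  have [st|/ltW ts] := leP s t; first by rewrite H// ler0_norm ?opprB// subr_le0.
  by rewrite metric_sym H// ger0_norm// subr_ge0.
move=> s0 st tD; apply/eqP; rewrite eq_le lip//=.
have := lip 0 s (lexx _) s0 (le_trans st tD).
have := lip t D (le_trans s0 st) tD (lexx _).
have := metric_triangle (g 0) (g s) (g D).
have := metric_triangle (g s) (g t) (g D).
lra.
Qed.

(** The point [f] stands for the antipodal function
    exp(- (f x + f y) / 2) rho (x, y). *)
Record moebiusPoint (R : realType) (A : antipodalSpace R) := MoebiusPoint {
  mp_fun :> A -> R;
  mp_extremal : extremal (log_kernel (A := A)) mp_fun
}.

Section MoebiusMetric.
Context {R : realType} (A : antipodalSpace R).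
Local Notation rho := (@as_rho R A).
Local Notation L := (log_kernel (A := A)).
Local Notation M := (moebiusPoint A).
Implicit Types (x y z : A) (f g h : M).

Lemma mp_inj f g : (f : A -> R) = g -> f = g.
Proof.
case: f g => [f ef] [g eg] /= fg; rewrite -fg in eg *.
by congr MoebiusPoint; exact: Prop_irrelevance.
Qed.

Lemma mp_bounded f : fbounded f.
Proof. by have [] := mp_extremal f. Qed.

Lemma mp_admissible f : admissible L f.
Proof. exact/extremal_admissible/mp_extremal/log_kernel_le0. Qed.

HB.instance Definition _ := gen_eqMixin M.
HB.instance Definition _ := gen_choiceMixin M.

Let mdist_xx f : sup_dist f f = 0.
Proof. exact/sup_distxx/as_point. Qed.

Let mdist_0 f g : sup_dist f g = 0 -> f = g.
Proof. by move=> fg; apply: mp_inj; apply: sup_dist0 fg; exact: mp_bounded. Qed.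

Let mdist_tri g f h : sup_dist f h <= sup_dist f g + sup_dist g h.
Proof. by apply: sup_dist_triangle; [exact: as_point|exact: mp_bounded..]. Qed.

HB.instance Definition _ := isMetric.Build R M mdist_xx mdist_0
  (fun f g => sup_dist_sym f g) mdist_tri.

Lemma mp_mdistE f g : mdist f g = sup_dist f g.
Proof. by []. Qed.

Lemma mp_mdist_ub f g x : `|f x - g x| <= mdist f g.
Proof. by apply: sup_dist_ub; exact: mp_bounded. Qed.

Lemma mp_mdist_le f g c : (forall x, `|f x - g x| <= c) -> mdist f g <= c.
Proof. by apply: sup_dist_le; exact: as_point. Qed.

Definition mp_origin : M := MoebiusPoint (extremal0 A).

Lemma mp_sup_normE f : sup_norm f = mdist f mp_origin.
Proof. by []. Qed.

Definition mp_retract (u : A -> R) : M :=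
  if pselect (admissible L u) is left au then
    MoebiusPoint (retract_extremal (@log_kernel_sym _ A) (@log_kernel_le0 _ A)
      (@log_kernel_max _ A) au)
  else mp_origin.

Lemma mp_retractE u : admissible L u -> mp_retract u = retract L u :> (A -> R).
Proof. by rewrite /mp_retract; case: pselect. Qed.

Lemma mp_retract_id f : mp_retract f = f.
Proof.
apply: mp_inj; rewrite mp_retractE; last exact: mp_admissible.
exact/retract_id/mp_extremal.
Qed.

Lemma mp_retract_lip u v c : admissible L u -> admissible L v ->
  (forall x, `|u x - v x| <= c) -> mdist (mp_retract u) (mp_retract v) <= c.
Proof.
move=> au av uv; apply: mp_mdist_le => x; rewrite !mp_retractE//.
apply: retract_lip => //;
  [exact: log_kernel_sym|exact: log_kernel_le0|exact: log_kernel_max].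
Qed.

(** The straight segment from [f] to [g] is admissible and has the right speed;
    the retraction does not increase distances and fixes the end points. *)
Lemma mp_geodesic : geodesic_space M.
Proof.
move=> f g; set D := mdist f g.
have [D0|D0] := eqVneq D 0.
  have fg : f = g by exact: mdist_positivity.
  exists (fun=> f); split=> // s t; rewrite /= D0 !in_itv/= => s0 t0.
  have [-> ->] : s = 0 /\ t = 0 by split; apply/eqP; rewrite eq_le andbC.
  by rewrite mdistxx subrr normr0.
have {D0} Dp : 0 < D by rewrite lt_neqAle eq_sym D0 mdist_ge0.
pose u s x := f x + s / D * (g x - f x).
have au s : 0 <= s -> s <= D -> admissible L (u s).
  move=> s0 sD; apply: admissible_convex; try exact: mp_admissible.
  by rewrite divr_ge0 ?(ltW Dp)//= ler_pdivrMr// mul1r.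
have u0 : u 0 = f by apply: funext => x; rewrite /u mul0r mul0r addr0.
have uD : u D = g by apply: funext => x; rewrite /u divff ?gt_eqF// mul1r addrC subrK.
exists (fun s => mp_retract (u s)); rewrite u0 uD !mp_retract_id; split=> //.
apply: geodesic_on_of_lip; last by rewrite u0 uD !mp_retract_id.
move=> s t s0 st tD; apply: mp_retract_lip.
- by apply: au => //; exact: le_trans tD.
- by apply: au => //; exact: le_trans st.
move=> x; rewrite /u.
have -> : f x + s / D * (g x - f x) - (f x + t / D * (g x - f x)) =
  (t - s) * ((f x - g x) / D) by ring.
rewrite normrM ger0_norm ?subr_ge0// -[leRHS]mulr1 ler_wpM2l ?subr_ge0//.
by rewrite normrM normfV (gtr0_norm Dp) ler_pdivrMr// mul1r mp_mdist_ub.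
Qed.

Definition mp_ray f x (t : R) : M := mp_retract (pull f x t).

Lemma mp_ray0 f x : mp_ray f x 0 = f.
Proof. by rewrite /mp_ray pull0 mp_retract_id. Qed.

Lemma mp_ray_lip f x s t : 0 <= s -> 0 <= t ->
  mdist (mp_ray f x s) (mp_ray f x t) <= `|s - t|.
Proof.
move=> s0 t0; apply: mp_retract_lip; try by apply: pull_admissible => //; exact: mp_admissible.
by move=> z; exact: pull_lip.
Qed.

(** Together with [mp_ray_lip] this forces the value f x - t: the ray moves
    towards [x] at unit speed. *)
Lemma mp_ray_le f x t : 0 <= t -> mp_ray f x t x <= f x - t.
Proof.
move=> t0; have ap := pull_admissible x t0 (mp_admissible f).
rewrite mp_retractE// (le_trans (retract_le _ _ _ ap x)) ?/pull ?eqxx//.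
- exact: log_kernel_sym.
- exact: log_kernel_le0.
- exact: log_kernel_max.
Qed.

End MoebiusMetric.

Section MoebiusComplete.
Context {R : realType} (A : antipodalSpace R).
Local Notation rho := (@as_rho R A).
Local Notation L := (log_kernel (A := A)).
Local Notation M := (moebiusPoint A).
Implicit Types (x y z : A) (f g h : M).

(** Both [f] and [g] lie on a geodesic line between [x] and [y], with [f]
    closer to [y]. *)
Lemma mp_opposite f g : exists x y,
  [/\ f x - g x = mdist f g, g y - f y = mdist f g, x != y,
      f x + f y = L x y & g x + g y = L x y].
Proof.
have [x fgx] := sup_dist_attained (mp_extremal f) (mp_extremal g).
rewrite -mp_mdistE in fgx.
have [y yx fxy] := extremal_attained x (mp_extremal f).
exists x, y; have xy : x != y by rewrite eq_sym.
have [_ /(_ _ _ xy) gxy] := mp_admissible g.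
have := mp_mdist_ub f g y; rewrite ler_norml => /andP[h _].
split=> //; lra.
Qed.

(** Let [x] and [y] be the points of [mp_opposite] for the end points f1 and f0
    of the segment. Continue beyond f1 by a ray to [y] and beyond f0 by a ray to
    [x]. The value at [y] then decreases at unit speed along the whole curve,
    which bounds distances from below. *)
Lemma mp_geodesically_complete : geodesically_complete M.
Proof.
move=> a b g ab geo; set f0 := g a; set f1 := g b.
have inI t : a <= t -> t <= b -> `[a, b]%classic t.
  by move=> ? ?; rewrite /= in_itv/=; apply/andP.
have dD : mdist f1 f0 = b - a.
  rewrite geo; [|by apply: inI => //; exact: ltW..].
  by rewrite gtr0_norm// subr_gt0.
have [x [y [Hx Hy xy f1L f0L]]] := mp_opposite f1 f0; rewrite dD in Hx Hy.
pose gam t := if t < a then mp_ray f0 x (a - t)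
              else if b < t then mp_ray f1 y (t - b) else g t.
exists gam; last first.
  move=> t; rewrite /= in_itv/= => /andP[ta tb].
  by rewrite /gam ltNge ta/= ltNge tb.
have gl t : t <= a -> gam t = mp_ray f0 x (a - t).
  rewrite le_eqVlt => /orP[/eqP ->|ta]; last by rewrite /gam ta.
  by rewrite /gam ltxx ltNge (ltW ab)/= subrr mp_ray0.
have gr t : b <= t -> gam t = mp_ray f1 y (t - b).
  rewrite le_eqVlt => /orP[/eqP <-|tb].
    by rewrite /gam ltxx ltNge (ltW ab)/= subrr mp_ray0.
  by rewrite /gam tb ltNge (ltW (lt_trans ab tb)).
have gm t : a <= t -> t <= b -> gam t = g t.
  by move=> ta tb; rewrite /gam ltNge ta/= ltNge tb.
have lip s t : s <= t -> mdist (gam s) (gam t) <= t - s.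
  have lipl u v : u <= v -> v <= a -> mdist (gam u) (gam v) <= v - u.
    move=> uv va; rewrite !gl//; last exact: le_trans va.
    have := @mp_ray_lip _ _ f0 x (a - u) (a - v); rewrite ger0_norm; lra.
  have lipr u v : u <= v -> b <= u -> mdist (gam u) (gam v) <= v - u.
    move=> uv va; rewrite !gr//; last exact: le_trans uv.
    have := @mp_ray_lip _ _ f1 y (u - b) (v - b); rewrite ler0_norm; lra.
  have lipm u v : u <= v -> a <= u -> v <= b -> mdist (gam u) (gam v) <= v - u.
    move=> uv au vb; rewrite !gm//; [|exact: le_trans uv|exact: le_trans vb].
    rewrite geo; [|by apply: inI => //; exact: le_trans vb|
                 by apply: inI => //; exact: le_trans uv].
    by rewrite ler0_norm; lra.
  have lipl2 u v : u <= v -> v <= b -> mdist (gam u) (gam v) <= v - u.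
    move=> uv vb; have [va|/ltW va] := leP v a; first exact: lipl.
    have [au|/ltW au] := leP a u; first exact: lipm.
    have := metric_triangle (gam u) (gam a) (gam v).
    have := lipl u a au (lexx _); have := lipm a v va (lexx _) vb; lra.
  move=> st; have [tb|/ltW tb] := leP t b; first exact: lipl2.
  have [bs|/ltW bs] := leP b s; first exact: lipr.
  have := metric_triangle (gam s) (gam b) (gam t).
  have := lipl2 s b bs (lexx _); have := lipr b t tb (lexx _); lra.
(* before time [a] the ray to [x] forces the value at [x] down, and admissibility
   at (x, y) turns this into a lower bound for the value at [y] *)
have gy t : gam t y = f1 y + b - t.
  have [tb|/ltW tb] := leP t b.
    have [aet|/ltW ta] := leP a t.
      have := geo a t (inI _ (lexx _) (ltW ab)) (inI _ aet tb).
      have := geo b t (inI _ (ltW ab) (lexx _)) (inI _ aet tb).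
      rewrite -/f0 -/f1 gm// ger0_norm ?subr_ge0// ler0_norm ?subr_le0// => d1 d0.
      have := mp_mdist_ub f1 (g t) y; have := mp_mdist_ub f0 (g t) y.
      by rewrite d0 d1 !ler_norml => /andP[? ?] /andP[? ?]; lra.
    rewrite gl//; have at0 : 0 <= a - t by lra.
    have := mp_ray_lip f0 x (lexx 0) at0; rewrite mp_ray0 sub0r normrN ger0_norm// => d0.
    have := mp_mdist_ub f0 (mp_ray f0 x (a - t)) y; rewrite ler_norml => /andP[? _].
    have := mp_ray_le f0 x at0.
    have [_ /(_ _ _ xy)] := mp_admissible (mp_ray f0 x (a - t)).
    lra.
  rewrite gr//; have tb0 : 0 <= t - b by lra.
  have := mp_ray_lip f1 y (lexx 0) tb0; rewrite mp_ray0 sub0r normrN ger0_norm// => d0.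
  have := mp_mdist_ub f1 (mp_ray f1 y (t - b)) y; rewrite ler_norml => /andP[_ ?].
  have := mp_ray_le f1 y tb0.
  lra.
have H s t : s <= t -> mdist (gam s) (gam t) = t - s.
  move=> st; apply/eqP; rewrite eq_le lip//=.
  have := mp_mdist_ub (gam s) (gam t) y; rewrite !gy ler_norml => /andP[_]; lra.
move=> s t _ _; have [st|/ltW ts] := leP s t.
  by rewrite H// ler0_norm ?opprB// subr_le0.
by rewrite metric_sym H// ger0_norm// subr_ge0.
Qed.

(** On a ball the profiles are bounded away from 0, where ln is Lipschitz. *)
Lemma mp_equicontinuous (C e : R) x : 0 < e ->
  \forall y \near x, forall f, sup_norm f <= C -> `|f x - f y| <= e.
Proof.
move=> e0; pose d := expR (- C) * (e / 2).
have d0 : 0 < d by rewrite mulr_gt0 ?expR_gt0//; lra.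
have [s s0 H] := rho_modulus A d0.
have := rho_near x s0; apply: filterS => y /H xy f fC.
have bf := mp_bounded f.
have low u : expR (- C) <= profile f u.
  rewrite ler_expR; have := le_sup_norm u bf; rewrite ler_norml => /andP[? _]; lra.
have half u v : `|profile f u - profile f v| <= d -> f u <= f v + e.
  rewrite ler_norml => /andP[_ uv].
  suff : profile f u <= expR ((f v + e - sup_norm f) / 2) by rewrite ler_expR; lra.
  have -> : (f v + e - sup_norm f) / 2 = (f v - sup_norm f) / 2 + e / 2 by field.
  rewrite expRD -/(profile f v).
  have h1 : d <= profile f v * (e / 2) by rewrite ler_wpM2r//; lra.
  have h2 : profile f v * (1 + e / 2) <= profile f v * expR (e / 2).
    by rewrite ler_wpM2l ?expR_ge1Dx// ltW// profile_gt0.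
  lra.
have pm := profile_modulus (mp_extremal f) d0 xy.
have := half _ _ pm; rewrite distrC in pm; have := half _ _ pm.
by rewrite ler_norml => ? ?; apply/andP; split; lra.
Qed.

(** An ultrafilter on a ball converges pointwise, hence uniformly by
    equicontinuity, and extremality passes to uniform limits. *)
Lemma mp_proper : proper_space M.
Proof.
move=> f0 r; set B := [set f | _]; rewrite compact_ultra => F UF FB.
have ev z : exists c : R, (fun f : M => f z) @ F --> c.
  have [c [_ Fc]] : (`[f0 z - r, f0 z + r]%classic `&`
      [set c : R | (fun f : M => f z) @ F --> c]) !=set0.
    have := @segment_compact R (f0 z - r) (f0 z + r).
    rewrite compact_ultra; apply; first exact: ultra_fmap.
    apply: (@filterS _ F _ B _ _ FB) => f /= fB.
    rewrite in_itv/=; have := le_trans (mp_mdist_ub f0 f z) fB.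
    by rewrite ler_norml => /andP[? ?]; apply/andP; split; lra.
  by exists c.
have [h Fh] := choice ev.
have hc z (e : R) : 0 < e -> F [set f : M | `|f z - h z| <= e].
  move=> e0; have /cvgrPdist_le/(_ e e0) := Fh z.
  by apply: filterS => f; rewrite distrC.
have BC f : B f -> sup_norm f <= sup_norm f0 + r.
  rewrite /B/= => fB; have := metric_triangle f f0 (mp_origin A).
  by rewrite (metric_sym f f0) -!mp_sup_normE; lra.
have unif (e : R) : 0 < e -> F [set f : M | forall z, `|f z - h z| <= e].
  move=> e0; have e30 : 0 < e / 3 by lra.
  have := (@compact_near_coveringP A [set: A]).1 (@as_compact _ A).
  move=> /(_ _ F (fun (f : M) z => `|f z - h z| <= e) _) H.
  have : F [set f : M | [set: A] `<=` (fun z => `|f z - h z| <= e)].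
    apply: H => x _.
    pose U := [set y | forall f, sup_norm f <= sup_norm f0 + r -> `|f x - f y| <= e / 3].
    have nU : nbhs x U by exact: mp_equicontinuous.
    exists (U, B `&` [set f : M | `|f x - h x| <= e / 3]).
      by split => //=; apply: filterI => //; exact: hc.
    move=> [y f] [/= Uy [Bf fx]].
    have fxy := Uy _ (BC _ Bf).
    have hxy : `|h x - h y| <= e / 3.
      apply/ler_addgt0Pr => d d0; have d20 : 0 < d / 2 by lra.
      have [g [[gx gy] Bg]] := @filter_ex _ F _ _
        (filterI (filterI (hc x _ d20) (hc y _ d20)) FB).
      have := Uy _ (BC _ Bg); move: gx gy; rewrite /= !ler_norml.
      by move=> /andP[? ?] /andP[? ?] /andP[? ?]; apply/andP; split; lra.
    move: fxy hxy fx; rewrite !ler_norml.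
    by move=> /andP[? ?] /andP[? ?] /andP[? ?]; apply/andP; split; lra.
  by apply: filterS => f fz z; exact: fz.
have eh : extremal L h.
  apply: (extremal_uniform_limit (@log_kernel_le0 _ A) (@log_kernel_max _ A)) => e e0.
  have [f fz] := @filter_ex _ F _ _ (unif e e0).
  by exists f => //; exact: mp_extremal.
exists (MoebiusPoint eh); split.
  apply: mp_mdist_le => z /=; apply/ler_addgt0Pr => e e0.
  have [f [fz fB]] := @filter_ex _ F _ _ (filterI (hc z e e0) FB).
  have := le_trans (mp_mdist_ub f0 f z) fB; move: fz; rewrite /= !ler_norml.
  by move=> /andP[? ?] /andP[? ?]; apply/andP; split; lra.
apply/cvg_ballP => e e0; have e20 : 0 < e / 2 by lra.
have := unif _ e20; apply: filterS => f fz; rewrite ballEmdist/=.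
have := @mp_mdist_le _ A (MoebiusPoint eh) f (e / 2) _.
by move=> H; apply: le_lt_trans (H _) _; [move=> z; rewrite distrC; exact: fz|lra].
Qed.

End MoebiusComplete.

(** * Compactification of the Moebius space by the antipodal space *)
Inductive hatMoebius (R : realType) (A : antipodalSpace R) :=
  Inner of moebiusPoint A | Ideal of A.
Arguments Inner {R A}.
Arguments Ideal {R A}.

Section Hat.
Context {R : realType} (A : antipodalSpace R).
Local Notation rho := (@as_rho R A).
Local Notation L := (log_kernel (A := A)).
Local Notation M := (moebiusPoint A).
Local Notation hat := (hatMoebius A).
Implicit Types (x y z : A) (f g h k : M) (p q r : hat).

(** Points are recorded by their Gromov products with ideal points, the base
    point being [0]: this is exp(-(p|z)). *)
Definition hat_profile p : A -> R :=
  match p with Inner f => profile f | Ideal x => fun z => rho (x, z) end.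

(** exp(-(p|q)) for the base point [0]. *)
Definition hat_prod p q : R :=
  match p, q with
  | Inner f, Inner g => expR (- (sup_norm f + sup_norm g - mdist f g) / 2)
  | Inner f, Ideal x => profile f x
  | Ideal x, Inner f => profile f x
  | Ideal x, Ideal y => rho (x, y)
  end.

Definition hat_dist p q : R := sup_dist (hat_profile p) (hat_profile q).

Lemma hat_profile_bounded p : fbounded (hat_profile p).
Proof.
exists 1 => z; case: p => [f|x] /=.
  by rewrite ger0_norm ?profile_le1 ?ltW ?profile_gt0//; exact: mp_bounded.
by rewrite ger0_norm ?rho_le1 ?rho_ge0.
Qed.

Lemma hat_prod_sym p q : hat_prod p q = hat_prod q p.
Proof.
case: p q => [f|x] [g|y] //=; last exact: rho_sym.
by rewrite (addrC (sup_norm f)) metric_sym.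
Qed.

Lemma hat_prod_Inner_ge p g z :
  hat_profile p z * weight g z <= hat_prod p (Inner g).
Proof.
case: p => [f|x] /=.
  rewrite -expRD ler_expR; have := mp_mdist_ub f g z; rewrite ler_norml => /andP[_ ?].
  by lra.
by rewrite mulrC rho_sym profile_ge//; exact: mp_extremal.
Qed.

(** With [hat_prod_Inner_ge]: hat_prod p (Inner g) is the maximum over [z] of
    hat_profile p z * weight g z, so that products with inner points are
    controlled by the profile alone. *)
Lemma hat_prod_Inner_attained p g : exists z,
  hat_prod p (Inner g) = hat_profile p z * weight g z.
Proof.
case: p => [f|x] /=.
  have [z fgz] := sup_dist_attained (mp_extremal f) (mp_extremal g).
  rewrite -mp_mdistE in fgz; exists z.
  by rewrite -expRD -fgz; congr expR; field.
have [y yx gxy] := extremal_attained x (mp_extremal g); exists y.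
rewrite mulrC rho_sym weight_rhoE// -(log_kernel_sym x) -gxy.
by congr expR; field.
Qed.

(** A maximum of functions that are 1-Lipschitz in the profile of [p], because
    the weights are at most 1. *)
Lemma hat_prod_lip p q r : `|hat_prod p r - hat_prod q r| <= hat_dist p q.
Proof.
case: r => [g|x]; last first.
  have E p' : hat_prod p' (Ideal x) = hat_profile p' x.
    by case: p'.
  by rewrite !E; apply: sup_dist_ub; exact: hat_profile_bounded.
have H p' q' : hat_prod p' (Inner g) <= hat_prod q' (Inner g) + hat_dist p' q'.
  have [z ->] := hat_prod_Inner_attained p' g.
  have := hat_prod_Inner_ge q' g z.
  have := sup_dist_ub (hat_profile_bounded p') (hat_profile_bounded q') z.
  rewrite -/(hat_dist p' q') ler_norml => /andP[_ h].
  have w0 := weight_gt0 g z; have w1 := weight_le1 z (mp_bounded g).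
  have d0 : 0 <= hat_dist p' q'.
    by apply: le_trans (sup_dist_ub (hat_profile_bounded p') (hat_profile_bounded q') z).
  by nra.
have := H p q; have := H q p; rewrite {1}/hat_dist sup_dist_sym -/(hat_dist p q).
by rewrite ler_norml => *; apply/andP; split; lra.
Qed.

(** For inner points this says (f|f) = (f|g) = (g|g), that is, f and g are at
    distance 0; ideal points are those whose product with themselves is 0. *)
Lemma hat_prod_inj p q : hat_prod p p = hat_prod p q ->
  hat_prod q q = hat_prod p q -> p = q.
Proof.
case: p q => [f|x] [g|y] /=.
- move=> /expR_inj + /expR_inj; rewrite !mdistxx => h1 h2.
  congr Inner; apply: mdist_positivity; lra.
- by rewrite rhoxx => _ /esym/eqP; rewrite gt_eqF// profile_gt0.
- by rewrite rhoxx => /esym/eqP; rewrite gt_eqF// profile_gt0.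
- by rewrite rhoxx => /esym/rho_eq0 ->.
Qed.

HB.instance Definition _ := gen_eqMixin hat.
HB.instance Definition _ := gen_choiceMixin hat.
HB.instance Definition _ := isPointed.Build hat (Inner (mp_origin A)).

Let hat_dist_xx p : hat_dist p p = 0.
Proof. exact/sup_distxx/as_point. Qed.

Let hat_dist_0 p q : hat_dist p q = 0 -> p = q.
Proof.
move=> pq; have H r : hat_prod p r = hat_prod q r.
  by apply/eqP; rewrite -subr_eq0 -normr_le0 -pq hat_prod_lip.
by apply: hat_prod_inj; [rewrite H hat_prod_sym|rewrite H].
Qed.

Let hat_dist_sym p q : hat_dist p q = hat_dist q p.
Proof. exact: sup_dist_sym. Qed.

Let hat_dist_tri q p r : hat_dist p r <= hat_dist p q + hat_dist q r.
Proof. by apply: sup_dist_triangle; [exact: as_point|exact: hat_profile_bounded..]. Qed.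

HB.instance Definition _ := isMetric.Build R hat hat_dist_xx hat_dist_0
  hat_dist_sym hat_dist_tri.

Lemma hat_mdistE p q : mdist p q = hat_dist p q.
Proof. by []. Qed.

Lemma hat_mdist_le p q c : (forall z, `|hat_profile p z - hat_profile q z| <= c) ->
  mdist p q <= c.
Proof. exact/sup_dist_le/as_point. Qed.

Lemma hat_prod_continuous : continuous (fun pq : hat * hat => hat_prod pq.1 pq.2).
Proof.
move=> [p q]; apply/cvgrPdist_lt => e e0; have e20 : 0 < e / 2 by lra.
exists (ball p (e / 2), ball q (e / 2)); first by split; exact: nbhsx_ballx.
move=> [p' q'] /= []; rewrite !ballEmdist/= => pp' qq'.
have := hat_prod_lip p p' q; have := hat_prod_lip q q' p'.
rewrite -!hat_mdistE !(hat_prod_sym _ p') => h1 h2.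
rewrite -[hat_prod p q](subrK (hat_prod p' q)) -addrA.
by rewrite (le_lt_trans (ler_normD _ _))//; lra.
Qed.

Lemma hat_prod_Inner_gt0 p g : 0 < hat_prod p (Inner g).
Proof. by case: p => [f|x] /=; exact: expR_gt0. Qed.

(** exp(-(p|q)_k), by the rule
    (p|q)_k = (p|q) - (p|k) - (q|k) + (k|k) for a change of base point. *)
Definition hat_visual k p q : R :=
  hat_prod p q * hat_prod (Inner k) (Inner k) /
  (hat_prod p (Inner k) * hat_prod q (Inner k)).

Lemma hat_visual_continuous k :
  continuous (fun pq : hat * hat => hat_visual k pq.1 pq.2).
Proof.
have ck : continuous (fun p => hat_prod p (Inner k)).
  have -> : (fun p => hat_prod p (Inner k)) = fun p => hat_prod (Inner k) p.
    by apply: funext => p; exact: hat_prod_sym.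
  have := @continuous_section hat hat R (fun pq => hat_prod pq.1 pq.2) (Inner k).
  by move=> /(_ hat_prod_continuous) ck p; exact: ck.
move=> [p q]; apply: cvgM.
  by apply: cvgM; [exact: hat_prod_continuous|exact: cvg_cst].
apply: cvgV; first by rewrite mulf_neq0// gt_eqF// hat_prod_Inner_gt0.
apply: cvgM.
  exact: (continuous_compose (@continuous_fst _ _) ck).
exact: (continuous_compose (@continuous_snd _ _) ck).
Qed.

Lemma hat_visual_Inner k f g :
  hat_visual k (Inner f) (Inner g) = expR (- gromov_product k f g).
Proof.
rewrite /hat_visual /= -!expRD -expRN -expRD; congr expR.
by rewrite /gromov_product mdistxx (metric_sym f k) (metric_sym g k); field.
Qed.

Lemma hat_visual_mixed k f x :
  hat_visual k (Inner f) (Ideal x) = expR ((f x - k x - mdist f k) / 2).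
Proof.
rewrite /hat_visual /= -!expRD -expRN -expRD; congr expR.
by rewrite mdistxx; field.
Qed.

Lemma hat_visual_Ideal k x y :
  hat_visual k (Ideal x) (Ideal y) = expR (- (k x + k y) / 2) * rho (x, y).
Proof.
rewrite /hat_visual /= -!expRD -expRN -mulrA -expRD mulrC; congr (expR _ * _).
by rewrite mdistxx; field.
Qed.

Lemma hat_visual_sym k p q : hat_visual k p q = hat_visual k q p.
Proof. by rewrite /hat_visual hat_prod_sym (mulrC (hat_prod p (Inner k))). Qed.

Lemma hat_visual_ge0 k p q : 0 <= hat_visual k p q.
Proof.
rewrite divr_ge0// mulr_ge0// ?(ltW (hat_prod_Inner_gt0 _ _))//.
case: p q => [f|x] [g|y] /=; try exact: expR_ge0; exact: rho_ge0.
Qed.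

Lemma hat_visual_le1 k p q : hat_visual k p q <= 1.
Proof.
have mixed f x : hat_visual k (Inner f) (Ideal x) <= 1.
  rewrite hat_visual_mixed expR_le1.
  by have := mp_mdist_ub f k x; rewrite ler_norml => /andP[_]; lra.
case: p q => [f|x] [g|y] //; last first.
- rewrite hat_visual_Ideal; have [->|xy] := eqVneq x y; first by rewrite rhoxx mulr0.
  rewrite -expR_log_kernel// -expRD expR_le1.
  by have [_ /(_ _ _ xy)] := mp_admissible k; lra.
- by rewrite hat_visual_sym.
rewrite hat_visual_Inner expR_le1 /gromov_product.
by have := metric_triangle f k g; rewrite (metric_sym f k); lra.
Qed.

Lemma hat_visual_self k f : hat_visual k (Inner f) (Inner f) = expR (- mdist k f).
Proof.
by rewrite hat_visual_Inner /gromov_product mdistxx; congr expR; lra.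
Qed.

(** Let f x = - |f|, where |f| is the sup norm. The point [x] has weight 1,
    whence profile f >= rho (x, .). Conversely, the weight of a point [y] away
    from [x] is small, because weight f y * rho (y, x) is at most
    profile f x = exp (- |f|); and the points [y] close to [x] contribute
    about rho (x, .). *)
Lemma hat_near_Ideal (e : R) : 0 < e -> exists T : R,
  forall f x, T <= sup_norm f -> f x = - sup_norm f ->
  mdist (Inner f) (Ideal x) <= e.
Proof.
move=> e0; have [s s0 H] := rho_modulus A e0.
pose m := Num.min s e; have m0 : 0 < m by rewrite lt_min s0.
(* this bound on the sup norm gives exp (- sup_norm f / 2) < m *)
exists (1 - 2 * ln m) => f x Tf fx.
pose w := expR (- sup_norm f / 2).
have wm : w < m by rewrite -[ltRHS](@lnK _ m) ?posrE// ltr_expR; lra.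
have [ws we] : w < s /\ w < e by move: wm; rewrite lt_min => /andP.
have w0 : 0 < w by exact: expR_gt0.
apply: hat_mdist_le => z /=; rewrite ger0_norm; last first.
  rewrite subr_ge0; have := profile_ge x z (mp_extremal f).
  by rewrite /weight fx addNr oppr0 mul0r expR0 mul1r.
rewrite lerBlDl; apply: (profile_le (mp_extremal f)).
  by have := rho_ge0 x z; lra.
move=> y; have wy0 := weight_gt0 f y; have wy1 := weight_le1 y (mp_bounded f).
have [xy|xy] := ltP (rho (x, y)) s.
  have := H x y xy z; rewrite ler_norml !(rho_sym z) => /andP[? _].
  have := rho_ge0 y z; nra.
have : weight f y * rho (y, x) <= w * w.
  rewrite (le_trans (profile_ge y x (mp_extremal f)))//.
  by rewrite /profile fx -expRD ler_expR; lra.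
rewrite (rho_sym y x) => h.
have : weight f y <= w.
  rewrite -(ler_pM2r w0) (le_trans _ h)// ler_wpM2l//; lra.
have := rho_ge0 y z; have := rho_le1 y z; have := rho_ge0 x z; nra.
Qed.

(** Rays from the origin to [x] come arbitrarily close to [Ideal x]. *)
Lemma Inner_dense : dense (range (@Inner R A)).
Proof.
move=> O [p Op] oO; have : nbhs p O by exact: open_nbhs_nbhs.
move=> /nbhs_ballP[e /= e0 pO].
case: p Op pO => [f|x] Op pO; first by exists (Inner f); split => //; exists f.
have e20 : 0 < e / 2 by lra.
have [T HT] := hat_near_Ideal e20.
pose t := Num.max T 0; have t0 : 0 <= t by rewrite le_max lexx orbT.
pose f := mp_ray (mp_origin A) x t.
have fx := mp_ray_le (mp_origin A) x t0.
have := mp_ray_lip (mp_origin A) x (lexx 0) t0.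
rewrite mp_ray0 sub0r normrN ger0_norm// metric_sym -mp_sup_normE -/f => ft.
have := le_sup_norm x (mp_bounded f); rewrite ler_norml => /andP[fx' _].
rewrite -/f /= in fx.
exists (Inner f); split; last by exists f.
apply: pO; rewrite ballEmdist/= metric_sym.
apply: (@le_lt_trans _ _ (e / 2)); last by lra.
have tT : T <= t by rewrite le_max lexx.
apply: HT; lra.
Qed.

Lemma Inner_lip f g : mdist (Inner f) (Inner g) <= mdist f g.
Proof.
apply: hat_mdist_le => z /=.
have le0 (u : M) : (u z - sup_norm u) / 2 <= 0.
  by have := le_sup_norm z (mp_bounded u); rewrite ler_norml => /andP[_]; lra.
rewrite (le_trans (expR_lip_nonpos _ _))//.
have := mp_mdist_ub f g z.
have := sup_norm_dist (mp_bounded f) (mp_bounded g).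
rewrite -mp_mdistE !ler_norml => /andP[? ?] /andP[? ?]; apply/andP; split; lra.
Qed.

Lemma Inner_continuous : continuous (@Inner R A).
Proof.
exact/lip_continuous/Inner_lip.
Qed.

(** The topology of the Moebius space is recovered from the continuous
    functions hat_visual k p p, which are exp (- d(k, f)) at inner points and
    0 at ideal points. *)
Lemma Inner_embedding : topological_embedding (@Inner R A).
Proof.
split; first by move=> f g [].
  exact: Inner_continuous.
move=> U oU.
pose V (i : M * R) := [set p | expR (- i.2) < hat_visual i.1 p p].
exists (\bigcup_(i in [set i | ball i.1 i.2 `<=` U]) V i).
  apply: bigcup_open => -[k e] _; rewrite /V/=.
  have cv : continuous (fun p => hat_visual k p p).
    exact: (continuous_compose (continuous_pair (fun p => cvg_id)
      (fun p => cvg_id)) (@hat_visual_continuous k)).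
  by apply: (continuousP _).1 cv [set x | expR (- e) < x] _; exact: open_gt.
apply/seteqP; split=> f.
  move=> Uf; have : nbhs f U by exact: open_nbhs_nbhs.
  move=> /nbhs_ballP[e /= e0 fU]; exists (f, e) => //.
  by rewrite /V/= hat_visual_self mdistxx ltr_expR ltrN2.
move=> [[k e] /= kU]; rewrite /V/= hat_visual_self ltr_expR ltrN2 => kf.
by apply: kU; rewrite ballEmdist.
Qed.

Lemma Ideal_continuous : continuous (@Ideal R A).
Proof.
apply: continuous_to_metric => x e e0; have e20 : 0 < e / 2 by lra.
have [s s0 H] := rho_modulus A e20; have := rho_near x s0.
apply: filterS => y xy; apply: (@le_lt_trans _ _ (e / 2)); last by lra.
by apply: hat_mdist_le => z /=; rewrite !(rho_sym _ z); exact: H.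
Qed.

(** An ultrafilter that contains a ball converges by properness. Otherwise send
    each inner point [f] to an ideal point where f is - |f|, and each ideal
    point to itself: this moves far away points very little
    ([hat_near_Ideal]), and the image converges in the antipodal space. *)
Lemma hat_compact : compact [set: hat].
Proof.
rewrite compact_ultra => F UF _.
have [[T FT]|nFT] := pselect (exists T : R, F (Inner @` [set f | mdist (mp_origin A) f <= T])).
  have : compact (Inner @` [set f | mdist (mp_origin A) f <= T]).
    apply: continuous_compact; last exact: mp_proper.
    exact: (continuous_subspaceT Inner_continuous).
  by rewrite compact_ultra => /(_ F UF FT)[p [_ Fp]]; exists p.
have ch p : exists x : A, match p with
    Inner f => f x = - sup_norm f | Ideal y => y = x end.
  case: p => [f|y]; last by exists y.
  have [x] := sup_dist_attained (mp_extremal (mp_origin A)) (mp_extremal f).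
  by rewrite sup_dist_sym -/(sup_norm f) /= sub0r => <-; exists x; rewrite opprK.
have [c cP] := choice ch.
have : compact [set: A] by exact: as_compact.
rewrite compact_ultra => /(_ (c @ F) (ultra_fmap c UF) filterT)[x [_ Fx]].
exists (Ideal x); split => //.
apply/cvg_ballP => e e0; have e20 : 0 < e / 2 by lra.
have e40 : 0 < e / 4 by lra.
have [T HT] := hat_near_Ideal e40.
have FT : F (~` (Inner @` [set f | mdist (mp_origin A) f <= T])).
  by have [FT|//] := in_ultra_setVsetC (Inner @` [set f | mdist (mp_origin A) f <= T]) UF;
    case: nFT; exists T.
have Fc : F [set p | ball (Ideal x) (e / 2) (Ideal (c p))].
  have := cvg_comp c Ideal Fx (@Ideal_continuous x).
  by move=> /cvg_ballP/(_ _ e20).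
apply: (@filterS _ F _ _ _ _ (filterI FT Fc)) => p [/= nT].
rewrite !ballEmdist/= => xc.
have := metric_triangle (Ideal x) (Ideal (c p)) p.
suff : mdist (Ideal (c p)) p <= e / 4 by lra.
have := cP p; case: p nT xc => [f|y] nT _.
  rewrite metric_sym; apply: HT.
  rewrite mp_sup_normE metric_sym leNgt; apply/negP => fT.
  by apply: nT; exists f => //=; exact: ltW.
by move=> <-; rewrite mdistxx ltW.
Qed.

Definition hat_gp_prod k (pq : hat * hat) : \bar R :=
  (- lne (hat_visual k pq.1 pq.2)%:E)%E.

Lemma expeR_hat_gp_prod k pq :
  fine (expeR (- hat_gp_prod k pq)) = hat_visual k pq.1 pq.2.
Proof.
rewrite /hat_gp_prod oppeK lneK//.
by rewrite in_itv/= lee_fin hat_visual_ge0 leey.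
Qed.

End Hat.

Section MoebiusSpace.
Context {R : realType} (A : antipodalSpace R).
Local Notation M := (moebiusPoint A).
Local Notation hat := (hatMoebius A).

Lemma notin_range_Inner (p : hat) : (~` range Inner) p -> exists x, p = Ideal x.
Proof. by case: p => [f nf|x _]; [case: nf; exists f|exists x]. Qed.

Lemma Ideal_notin_range (x : A) : (~` range Inner) (Ideal x : hat).
Proof. by case. Qed.

Lemma hat_gp_prodE (k f g : M) :
  hat_gp_prod k (Inner f, Inner g) = (gromov_product k f g)%:E.
Proof.
by rewrite /hat_gp_prod hat_visual_Inner lne_EFin ?expR_gt0// expRK EFinN oppeK.
Qed.

Lemma hat_gp_prod_pinfty (k : M) (p q : hat) :
  (~` range Inner) p -> (~` range Inner) q ->
  (hat_gp_prod k (p, q) = +oo%E <-> p = q).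
Proof.
move=> /notin_range_Inner[x ->] /notin_range_Inner[y ->].
rewrite /hat_gp_prod hat_visual_Ideal /=; split=> [|[->]]; last first.
  by rewrite rhoxx mulr0 lexx.
case: ifPn => [rho0 _|//]; congr Ideal; apply/rho_eq0; apply/eqP.
by rewrite eq_le rho_ge0 andbT -(@pmulr_rle0 _ (expR (- (k x + k y) / 2)))// expR_gt0.
Qed.

Lemma hat_gp_prod_ge0 (k : M) pq : (0 <= hat_gp_prod k pq)%E.
Proof. by rewrite oppe_ge0 lne_le0 lee_fin hat_visual_le1. Qed.

Lemma hat_gp_prod_continuous (k : M) : continuous (hat_gp_prod k).
Proof.
apply: neg_lne_continuous; first exact: hat_visual_continuous.
by move=> pq; exact: hat_visual_ge0.
Qed.

Definition hat_compactification : gp_compactification M :=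
  @GPCompactification R M hat Inner (@hat_gp_prod R A)
    (@hat_compact R A) (@metric_hausdorff R hat)
    (compact_second_countable (@hat_compact R A)) (@Inner_embedding R A)
    (@Inner_dense R A) hat_gp_prod_continuous hat_gp_prod_ge0 hat_gp_prodE
    hat_gp_prod_pinfty.

Definition moebiusSpace : gromovProductSpace R :=
  @GromovProductSpace R M (@mp_proper R A) (@mp_geodesic R A)
    (@mp_geodesically_complete R A) hat_compactification.

End MoebiusSpace.

(** * Derivatives of Moebius equivalent functions *)
Section Derivative.
Context {R : realType} {Z : topologicalType}.
Implicit Types (rho : Z * Z -> R) (D : Z -> R).

Lemma has_third (x y : Z) : has_four_points Z -> exists z, x <> z /\ y <> z.
Proof.
move=> [a [b [c [d]]]] /=; rewrite !inE !negb_or !andbT.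
move=> /andP[/and3P[/eqP ab /eqP ac /eqP ad] /andP[/andP[/eqP bc /eqP bd] /eqP cd]].
have [xa|xa] := pselect (x = a); have [ya|ya] := pselect (y = a).
- by exists b; rewrite xa ya.
- have [yb|yb] := pselect (y = b); first by exists c; rewrite xa yb.
  by exists b; rewrite xa.
- have [xb|xb] := pselect (x = b); first by exists c; rewrite ya xb.
  by exists b; rewrite ya.
- by exists a.
Qed.

(** The products D x D y are determined for x <> y, and
    (D x)^2 = (D x D y) (D x D z) / (D y D z). *)
Lemma moebius_derivative_unique rho1 rho2 D D' :
  separating rho1 -> has_four_points Z ->
  is_moebius_derivative rho1 rho2 D -> is_moebius_derivative rho1 rho2 D' ->
  D = D'.
Proof.
move=> [_ _ _ s0] h4 [_ D0 DE] [_ D0' DE'].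
apply: funext => x.
have [y [xy _]] := has_third x x h4; have [z [xz yz]] := has_third x y h4.
have E a b : a <> b -> D a * D b = D' a * D' b.
  move=> ab; have r0 : rho1 (a, b) ^+ 2 != 0.
    by rewrite sqrf_eq0; apply/eqP => /s0.
  by apply: (mulIf r0); rewrite -DE -DE'.
have := E x y xy; have := E x z xz; have := E y z yz => e1 e2 e3.
have : D x ^+ 2 * (D y * D z) = D' x ^+ 2 * (D y * D z).
  rewrite {2}e1; transitivity ((D x * D y) * (D x * D z)); first by ring.
  by rewrite e2 e3; ring.
have DD : D y * D z != 0 by rewrite mulf_neq0// gt_eqF.
move=> /(mulIf DD)/eqP; rewrite eqrXn2// ?ltW//; first by move=> /eqP.
Qed.

Lemma moebius_derivativeE rho1 rho2 D :
  separating rho1 -> has_four_points Z -> is_moebius_derivative rho1 rho2 D ->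
  moebius_derivative rho1 rho2 = D.
Proof.
move=> s4 h4 dD; apply: (moebius_derivative_unique s4 h4 _ dD).
rewrite /moebius_derivative; case: xgetP => [E -> //|nD].
by have := nD D; rewrite /= => /(_ dD).
Qed.

Lemma cross_ratio_conformal rho1 rho2 (u : Z -> R) a b c d :
  (forall x, 0 < u x) ->
  (forall x y, rho2 (x, y) = u x * u y * rho1 (x, y)) ->
  cross_ratio rho2 a b c d = cross_ratio rho1 a b c d.
Proof.
move=> u0 E; rewrite /cross_ratio !E.
set U := u a * u b * u c * u d.
have U0 : U != 0 by rewrite !mulf_neq0// gt_eqF.
have -> : u a * u c * rho1 (a, c) * (u b * u d * rho1 (b, d)) =
  U * (rho1 (a, c) * rho1 (b, d)) by rewrite /U; ring.
have -> : u a * u d * rho1 (a, d) * (u b * u c * rho1 (b, c)) =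
  U * (rho1 (a, d) * rho1 (b, c)) by rewrite /U; ring.
by rewrite -mulf_div divff// mul1r.
Qed.

End Derivative.

Section DerivativeExists.
Context {R : realType} {Z : topologicalType}.
Implicit Types rho : Z * Z -> R.

Section Existence.
Variables rho1 rho2 : Z * Z -> R.
Hypotheses (hZ : hausdorff_space Z) (h4 : has_four_points Z).
Hypotheses (s1 : separating rho1) (s2 : separating rho2).
Hypothesis equiv : moebius_equiv rho1 rho2.

Let r x y : R := rho2 (x, y) / rho1 (x, y).

Lemma separating_gt0 rho x y : separating rho -> x <> y -> 0 < rho (x, y).
Proof.
move=> [_ ge0 _ eq0] xy; rewrite lt_neqAle ge0 andbT.
by apply/eqP => /esym/eq0.
Qed.

Let r_gt0 x y : x <> y -> 0 < r x y.
Proof. by move=> xy; rewrite divr_gt0// separating_gt0. Qed.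

Let r_sym x y : r x y = r y x.
Proof. by have [[_ _ e1 _] [_ _ e2 _]] := (s1, s2); rewrite /r e1 e2. Qed.

(** If rho2^2 = D x D y rho1^2, then sqrt(D x D y) is the quotient [r x y], so
    this is D x for any [a] and [b]. *)
Definition three_point_derivative x a b : R := r x a * r x b / r a b.
Local Notation T := three_point_derivative.

Let T_sym x a b : T x a b = T x b a.
Proof. by rewrite /T (r_sym a) (mulrC (r x a)). Qed.

Let T_change x a b c : x <> a -> x <> b -> a <> b -> x <> c -> a <> c ->
  T x a b = T x a c.
Proof.
move=> xa xb ab xc ac; have [<-//|bc] := pselect (b = c).
have u : uniq [:: x; a; b; c].
  by rewrite /= !inE !negb_or; do !(apply/andP; split); apply/eqP.
have := equiv u; rewrite /cross_ratio /T /r.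
have p1 y z : y <> z -> 0 < rho1 (y, z) by exact: separating_gt0.
have p2 y z : y <> z -> 0 < rho2 (y, z) by exact: separating_gt0.
have := p1 _ _ xa; have := p1 _ _ xb; have := p1 _ _ ab; have := p1 _ _ xc.
have := p1 _ _ ac; have := p2 _ _ xa; have := p2 _ _ xb; have := p2 _ _ ab.
have := p2 _ _ xc; have := p2 _ _ ac.
move: (rho1 (x, a)) (rho1 (x, b)) (rho1 (a, b)) (rho1 (x, c)) (rho1 (a, c)).
move: (rho2 (x, a)) (rho2 (x, b)) (rho2 (a, b)) (rho2 (x, c)) (rho2 (a, c)).
move=> xa2 xb2 ab2 xc2 ac2 xa1 xb1 ab1 xc1 ac1.
do 10 (move=> /lt0r_neq0 ?).
move=> /eqP; rewrite eqr_div ?mulf_neq0// => /eqP E.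
have E' : (xb1 * ac1) * (xc2 * ab2) = (xb2 * ac2) * (xc1 * ab1) by [].
have -> : xa2 / xa1 * (xb2 / xb1) / (ab2 / ab1) =
  xa2 / xa1 * ((xb2 * ab1) / (xb1 * ab2)) by field; do !(apply/andP; split).
have -> : xa2 / xa1 * (xc2 / xc1) / (ac2 / ac1) =
  xa2 / xa1 * ((xc2 * ac1) / (xc1 * ac2)) by field; do !(apply/andP; split).
congr (_ * _); apply/eqP; rewrite eqr_div ?mulf_neq0//; apply/eqP.
transitivity ((xb2 * ac2) * (xc1 * ab1)); first by ring.
by rewrite -E'; ring.
Qed.

Let T_indep x a b a' b' : x <> a -> x <> b -> a <> b ->
  x <> a' -> x <> b' -> a' <> b' -> T x a b = T x a' b'.
Proof.
move=> xa xb ab xa' xb' ab'.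
have [ab1|ab1] := pselect (a = b').
  have aa' : a <> a' by rewrite ab1; exact: nesym.
  by rewrite (T_change xa xb ab xa' aa') T_sym ab1.
rewrite (T_change xa xb ab xb' ab1) T_sym (T_change xb' xa (nesym ab1) xa' (nesym ab')).
exact: T_sym.
Qed.

(** Invariance of the cross-ratio makes [three_point_derivative] independent of
    the auxiliary points; these can be kept fixed near a given point, which
    gives continuity. *)
Lemma moebius_derivative_exists : exists D, is_moebius_derivative rho1 rho2 D.
Proof.
have ab x : exists p : Z * Z, [/\ x <> p.1, x <> p.2 & p.1 <> p.2].
  have [a [xa _]] := has_third x x h4; have [b [xb ab]] := has_third x a h4.
  by exists (a, b).
have [p pP] := choice ab; pose D x := T x (p x).1 (p x).2.
have DE x a b : x <> a -> x <> b -> a <> b -> D x = T x a b.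
  by move=> ? ? ?; have [? ? ?] := pP x; exact: T_indep.
exists D; split.
- move=> x; have [xa xb pab] := pP x; set a := (p x).1 in xa pab; set b := (p x).2 in xb pab.
  have ne c : x <> c -> \forall y \near x, y <> c.
    move=> xc; apply: open_nbhs_nbhs; split => //.
    apply: (@closed_openC _ [set c]); apply: accessible_closed_set1.
    exact: hausdorff_accessible.
  have cr c : x <> c -> (fun y => r y c) @ x --> r x c.
    move=> xc; have cs rho : separating rho -> (fun y => rho (y, c)) @ x --> rho (x, c).
      move=> [cr _ sr _].
      have -> : (fun y => rho (y, c)) = (fun y => rho (c, y)).
        by apply: funext => y; exact: sr.
      by rewrite sr; exact: (@continuous_section _ _ _ rho c cr x).
    apply: cvgM; first exact: cs.
    by apply: cvgV; [rewrite gt_eqF// separating_gt0|exact: cs].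
  apply: (@cvg_trans _ ((fun y => T y a b) @ x)).
    apply: near_eq_cvg; apply: filterS (filterI (ne _ xa) (ne _ xb)) => y [ya yb].
    by rewrite (DE y a b).
  by apply: cvgM; [apply: cvgM; exact: cr|exact: cvg_cst].
- by move=> x; have [? ? ?] := pP x; apply: divr_gt0; [apply: mulr_gt0|]; exact: r_gt0.
move=> x y; have [<-|xy] := pselect (x = y).
  have [[_ _ _ e1] [_ _ _ e2]] := (s1, s2).
  by rewrite (e1 x x).2// (e2 x x).2// expr0n/= mulr0.
have [z [xz yz]] := has_third x y h4.
rewrite (DE x y z)// (DE y x z)//; last exact: nesym.
have xyr := r_gt0 xy; have xzr := r_gt0 xz; have yzr := r_gt0 yz.
have r1 := separating_gt0 s1 xy.
have -> : T x y z * T y x z = r x y ^+ 2.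
  by rewrite /T (r_sym y x); field; rewrite !gt_eqF.
by rewrite /r exprMn exprVn mulfVK// sqrf_eq0 gt_eqF.
Qed.

End Existence.

End DerivativeExists.

(** * Visual functions of a Gromov product space *)
Section Visual.
Context {R : realType} (X : gromovProductSpace R).
Local Notation hat := (gp_hat X).
Local Notation i := (gpc_incl (gp_hat X)).
Implicit Types (x y z : X) (p q : hat).

(** exp(-(.|.)_x) on the whole compactification. Being real valued and
    continuous, it avoids arithmetic in the extended reals; identities and
    inequalities extend to it from X by density. *)
Definition exp_gromov x (pq : hat * hat) : R := fine (expeR (- gpc_prod x pq)).

Lemma visualE x (xi eta : gp_boundary X) :
  visual x (xi, eta) = exp_gromov x (set_val xi, set_val eta).
Proof. by []. Qed.

Lemma exp_gromov_continuous x : continuous (exp_gromov x).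
Proof.
apply: expR_neg_continuous; [exact: gpc_prod_continuous|exact: gpc_prod_ge0].
Qed.

Lemma exp_gromov_incl x y z : exp_gromov x (i y, i z) = expR (- gromov_product x y z).
Proof. by rewrite /exp_gromov gpc_prodE. Qed.

Lemma exp_gromov_self x y : exp_gromov x (i y, i y) = expR (- mdist x y).
Proof. by rewrite exp_gromov_incl /gromov_product mdistxx; congr expR; lra. Qed.

Lemma exp_gromov_ge0 x pq : 0 <= exp_gromov x pq.
Proof. by rewrite fine_ge0// expeR_ge0. Qed.

Lemma exp_gromov_le1 x pq : exp_gromov x pq <= 1.
Proof.
rewrite /exp_gromov; have := gpc_prod_ge0 x pq.
by case: (gpc_prod x pq) => [r| |]//=; rewrite lee_fin => r0; rewrite expR_le1; lra.
Qed.

Lemma exp_gromov_eq0 x pq : exp_gromov x pq = 0 <-> gpc_prod x pq = +oo%E.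
Proof.
rewrite /exp_gromov; have := gpc_prod_ge0 x pq.
case: (gpc_prod x pq) => [r| |]//= _.
by split=> // /eqP; rewrite expR_eq0.
Qed.

Lemma exp_gromov_boundary x xi eta : gp_boundary X xi -> gp_boundary X eta ->
  (exp_gromov x (xi, eta) = 0 <-> xi = eta).
Proof. by move=> bxi beta; rewrite exp_gromov_eq0; exact: gpc_prod_pinfty. Qed.

Lemma gp_dense : dense (range i).
Proof. exact: gpc_incl_dense. Qed.

Lemma gp_inhabited (xi : hat) : exists x : X, True.
Proof.
by have [_ [_ [x _ _]]] := @gp_dense setT (ex_intro _ xi I) openT; exists x.
Qed.

Lemma exp_gromov_sym x p q : exp_gromov x (p, q) = exp_gromov x (q, p).
Proof.
have := @dense_pair_eq X hat R i (exp_gromov x) (fun pq => exp_gromov x (pq.2, pq.1))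
  (@norm_hausdorff _ _) gp_dense (@exp_gromov_continuous x).
move=> /(_ _ _)/(congr1 (fun f => f (p, q))); apply.
  apply: (@continuous_compose _ _ _ (fun pq : hat * hat => (pq.2, pq.1))).
    by apply: continuous_pair; [exact: continuous_snd|exact: continuous_fst].
  exact: exp_gromov_continuous.
move=> s t /=; rewrite !exp_gromov_incl /gromov_product (metric_sym t s).
by congr expR; lra.
Qed.

Lemma exp_gromov_diag_continuous x : continuous (fun q => exp_gromov x (q, q)).
Proof.
apply: (@continuous_compose _ _ _ (fun q : hat => (q, q))).
  exact: (continuous_pair (fun p => cvg_id) (fun p => cvg_id)).
exact: exp_gromov_continuous.
Qed.

Lemma exp_gromov_section_continuous x p : continuous (fun q => exp_gromov x (p, q)).
Proof. exact/continuous_section/exp_gromov_continuous. Qed.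

Lemma exp_gromov_incl_ge x y q : expR (- mdist x y) <= exp_gromov x (i y, q).
Proof.
apply: (@dense_closed hat (range i) [set q | expR (- mdist x y) <= exp_gromov x (i y, q)]).
- exact: gp_dense.
- apply: ((continuous_closedP _).1 (@exp_gromov_section_continuous x (i y)) [set r | _ <= r]).
  exact: closed_ge.
move=> _ [z _ <-] /=; rewrite exp_gromov_incl ler_expR /gromov_product.
by have := metric_triangle x y z; lra.
Qed.

Lemma exp_gromov_incl_gt0 x y q : 0 < exp_gromov x (i y, q).
Proof. exact: lt_le_trans (expR_gt0 _) (exp_gromov_incl_ge x y q). Qed.

(** (q|q)_x is the distance from [x] to [q] if [q] is in X. *)
Lemma exp_gromov_diag_eq0 x q : exp_gromov x (q, q) = 0 <-> gp_boundary X q.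
Proof.
split=> [q0 [y _ yq]|bq]; last exact/exp_gromov_boundary.
by have := exp_gromov_incl_gt0 x y q; rewrite yq q0 ltxx.
Qed.

Lemma exp_gromov_base_change x x' p q :
  exp_gromov x' (p, q) * (exp_gromov x (i x', p) * exp_gromov x (i x', q)) =
  exp_gromov x (p, q) * expR (- mdist x x').
Proof.
have cs := @exp_gromov_section_continuous x (i x').
have := @dense_pair_eq X hat R i
  (fun pq => exp_gromov x' pq * (exp_gromov x (i x', pq.1) * exp_gromov x (i x', pq.2)))
  (fun pq => exp_gromov x pq * expR (- mdist x x'))
  (@norm_hausdorff _ _) gp_dense.
move=> /(_ _ _ _)/(congr1 (fun f => f (p, q))); apply.
- move=> pq; apply: cvgM; first exact: exp_gromov_continuous.
  apply: cvgM; first exact: (continuous_compose (@continuous_fst _ _) cs).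
  exact: (continuous_compose (@continuous_snd _ _) cs).
- by move=> pq; apply: cvgM; [exact: exp_gromov_continuous|exact: cvg_cst].
- move=> s t /=; rewrite !exp_gromov_incl -!expRD; congr expR.
  rewrite /gromov_product; lra.
Qed.

(** On the compact set [C], the continuous function exp(-(q|q)_x) reaches its
    infimum, which is 0. *)
Lemma boundary_point_in_closed x (C : set hat) : closed C ->
  (forall n : R, exists2 q, C q & exp_gromov x (q, q) <= expR (- n)) ->
  exists2 xi, C xi & gp_boundary X xi.
Proof.
move=> cC Cn; have cptC : compact C.
  exact: (subclosed_compact cC (@gpc_compact _ _ hat)).
have [||c /set_mem Cc H] := @compact_EVT_min hat R (fun q => exp_gromov x (q, q)) C _ cptC.
- by have [q Cq _] := Cn 0; exists q.
- exact: (continuous_subspaceT (@exp_gromov_diag_continuous x)).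
exists c => //; apply/(exp_gromov_diag_eq0 x); apply/eqP.
rewrite eq_le exp_gromov_ge0 andbT leNgt; apply/negP => c0.
(* the exponent is chosen so that [q] beats the minimum reached at [c] *)
have [q Cq] := Cn (1 - ln (exp_gromov x (c, c))).
apply/negP; rewrite -ltNge.
apply: lt_le_trans (H q (mem_set Cq)).
by rewrite -[ltRHS](@lnK _ (exp_gromov x (c, c))) ?posrE// ltr_expR; lra.
Qed.

Lemma geodesic_extension x y (n : R) : x <> y -> 0 <= n ->
  exists2 z, mdist x z = n & mdist y z = mdist x y + n.
Proof.
move=> xy n0; have d0 : 0 < mdist x y by rewrite mdist_gt0; exact/eqP.
have [g [gg g0 gd]] := gp_geodesic x y.
have [gam ggam gamE] := gp_complete d0 gg.
have gamx : gam 0 = x by rewrite gamE// /= in_itv/= lexx ltW.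
have gamy : gam (mdist x y) = y by rewrite gamE// /= in_itv/= lexx ltW.
exists (gam (- n)).
  by rewrite -{1}gamx ggam// opprK add0r ger0_norm.
by rewrite -{1}gamy ggam// opprK ger0_norm// addr_ge0// ltW.
Qed.

Lemma other_point x (xi : hat) : gp_boundary X xi -> exists y, x <> y.
Proof.
move=> bxi; apply: contrapT => /forallNP H.
have /(exp_gromov_diag_eq0 x) := bxi; apply/eqP.
suff -> : exp_gromov x (xi, xi) = 1 by rewrite oner_eq0.
apply: (@dense_closed hat (range i) [set q | exp_gromov x (q, q) = 1]).
- exact: gp_dense.
- apply: ((continuous_closedP _).1 (@exp_gromov_diag_continuous x) [set r | r = 1]).
  exact: closed_eq.
move=> _ [z _ <-] /=; have [<-|/H//] := pselect (x = z).
by rewrite exp_gromov_self mdistxx oppr0 expR0.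
Qed.

(** For [y] in X, the geodesic from [y] to [x] can be prolonged beyond [x] by
    any length, to a point [z] with (y|z)_x = 0. By compactness, such points
    [z] also exist when [y] is replaced with a boundary point, and
    [boundary_point_in_closed] provides one in the boundary. *)
Lemma opposite_point x xi : gp_boundary X xi ->
  exists2 eta, gp_boundary X eta & exp_gromov x (xi, eta) = 1.
Proof.
move=> bxi.
have [//||eta Ceta beta] := @boundary_point_in_closed x [set q | exp_gromov x (xi, q) = 1].
- apply: ((continuous_closedP _).1 (@exp_gromov_section_continuous x xi) [set r | r = 1]).
  exact: closed_eq.
- move=> n0; pose n := Num.max n0 0.
  have n_ge0 : 0 <= n by rewrite le_max lexx orbT.
  (* the first projection of [S] is closed and contains X *)
  pose S := [set pq : hat * hat | exp_gromov x pq = 1] `&`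
            [set pq | exp_gromov x (pq.2, pq.2) <= expR (- n)].
  have cS : closed S.
    apply: closedI.
      apply: ((continuous_closedP _).1 (@exp_gromov_continuous x) [set r | r = 1]).
      exact: closed_eq.
    have c2 := continuous_compose (@continuous_snd hat hat) (@exp_gromov_diag_continuous x).
    apply: ((continuous_closedP _).1 c2 [set r | r <= expR (- n)]).
    exact: closed_le.
  have cptS : compact S.
    apply: (@subclosed_compact _ S [set: hat * hat] cS) => //; rewrite -setXTT.
    by apply: compact_setX; exact: gpc_compact.
  have cptP : compact (fst @` S).
    by apply: continuous_compact => //; exact: (continuous_subspaceT (@continuous_fst _ _)).
  have clP : closed (fst @` S).
    by apply: compact_closed => //; exact: gpc_hausdorff.
  have : (fst @` S) xi.
    apply: (@dense_closed hat (range i)) => //; first exact: gp_dense.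
    move=> _ [y _ <-].
    have [z xz] : exists2 z, mdist x z = n & gromov_product x y z = 0.
      have [<-|xy] := pselect (x = y).
        have [y' xy'] := other_point x bxi.
        have [z xz _] := geodesic_extension xy' n_ge0.
        by exists z => //; rewrite /gromov_product mdistxx; lra.
      have [z xz yz] := geodesic_extension xy n_ge0.
      by exists z => //; rewrite /gromov_product xz yz; lra.
    move=> gp0; exists (i y, i z) => //; split => /=.
      by rewrite exp_gromov_incl gp0 oppr0 expR0.
    by rewrite exp_gromov_self xz.
  move=> [[p q] [/= pq1 qn]] pxi; exists q; first by rewrite -pxi.
  by rewrite (le_trans qn)// ler_expR lerN2 le_max lexx.
by exists eta.
Qed.

(** The limit of prolongations beyond [x'] of the geodesic from [x] to [x']. *)
Lemma ray_through x x' : x <> x' ->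
  exists2 xi, gp_boundary X xi & exp_gromov x (i x', xi) = expR (- mdist x x').
Proof.
move=> xx'.
have [//||xi Cxi bxi] := @boundary_point_in_closed x
  [set q | exp_gromov x (i x', q) = expR (- mdist x x')].
- apply: ((continuous_closedP _).1 (@exp_gromov_section_continuous x (i x')) [set r | r = _]).
  exact: closed_eq.
- move=> n0; pose n := Num.max n0 0.
  have n_ge0 : 0 <= n by rewrite le_max lexx orbT.
  have [z x'z xz] := geodesic_extension (nesym xx') n_ge0.
  exists (i z) => /=.
    rewrite exp_gromov_incl /gromov_product xz x'z (metric_sym x' x); congr expR; lra.
  have nn : n0 <= n by rewrite le_max lexx.
  rewrite exp_gromov_self xz ler_expR; have := mdist_ge0 x' x; lra.
by exists xi.
Qed.

Lemma boundary_compact : compact [set: gp_boundary X].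
Proof.
have [[xi bxi]|n0] := pselect (gp_boundary X !=set0); last first.
  move=> F PF _; have [z _] := @filter_ex _ F PF _ filterT.
  by case: n0; exists (set_val z); exact: set_valP.
have [x _] := gp_inhabited xi.
apply: set_type_compact; apply: (subclosed_compact _ (@gpc_compact _ _ hat)) => //.
have -> : gp_boundary X = [set q | exp_gromov x (q, q) = 0].
  by apply/seteqP; split => q /(exp_gromov_diag_eq0 x).
apply: ((continuous_closedP _).1 (@exp_gromov_diag_continuous x) [set r | r = 0]).
exact: closed_eq.
Qed.

Lemma visual_separating x : separating (@visual R X x).
Proof.
split.
- apply: (@continuous_compose _ _ _ (fun p : gp_boundary X * gp_boundary X =>
    (set_val p.1, set_val p.2)) (exp_gromov x)); last exact: exp_gromov_continuous.
  apply: continuous_pair.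
    exact: (continuous_compose (@continuous_fst _ _) (@set_val_continuous _ _)).
  exact: (continuous_compose (@continuous_snd _ _) (@set_val_continuous _ _)).
- by move=> xi eta; exact: exp_gromov_ge0.
- by move=> xi eta; exact: exp_gromov_sym.
- move=> xi eta; rewrite visualE exp_gromov_boundary; try exact: set_valP.
  by split=> [/val_inj|->].
Qed.

Lemma visual_antipodal x (xi0 : gp_boundary X) : antipodal (@visual R X x).
Proof.
have opp xi : exists eta : gp_boundary X, visual x (xi, eta) = 1.
  have [eta beta xieta] := opposite_point x (set_valP xi).
  by exists (exist _ eta (mem_set beta)).
split; [exact: visual_separating| |exact: opp].
apply/eqP; rewrite eq_le; apply/andP; split.
  apply: ge_sup; first by exists (visual x (xi0, xi0)), (xi0, xi0).
  by move=> _ [p _ <-]; exact: exp_gromov_le1.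
apply: ub_le_sup; last by have [eta] := opp xi0; exists (xi0, eta).
by exists 1 => _ [p _ <-]; exact: exp_gromov_le1.
Qed.

(** The exponential of the Busemann function 2 (x'|xi)_x - d(x, x'), which is
    the limit of d(x, y) - d(x', y) as [y] tends to [xi]. *)
Definition busemann_derivative x x' (xi : gp_boundary X) : R :=
  expR (- mdist x x') / exp_gromov x (i x', set_val xi) ^+ 2.

Lemma busemann_derivativeP x x' :
  is_moebius_derivative (visual x) (visual x') (busemann_derivative x x').
Proof.
have a0 (xi : gp_boundary X) : 0 < exp_gromov x (i x', set_val xi).
  exact: exp_gromov_incl_gt0.
split.
- have c : continuous (fun xi : gp_boundary X => exp_gromov x (i x', set_val xi)).
    exact: (continuous_compose (@set_val_continuous _ _)
      (@exp_gromov_section_continuous x (i x'))).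
  move=> xi.
  have a2 : exp_gromov x (i x', set_val xi) * exp_gromov x (i x', set_val xi) != 0.
    by rewrite mulf_neq0// gt_eqF.
  exact: (cvgM (cvg_cst (expR (- mdist x x'))) (cvgV a2 (cvgM (c xi) (c xi)))).
- by move=> xi; rewrite divr_gt0 ?expR_gt0// exprn_gt0.
move=> xi eta; rewrite !visualE.
have := exp_gromov_base_change x x' (set_val xi) (set_val eta).
rewrite /busemann_derivative.
move: (a0 xi) (a0 eta).
set a := exp_gromov x (i x', set_val xi); set b := exp_gromov x (i x', set_val eta).
set e := expR _; move=> ap bp E.
have -> : exp_gromov x' (set_val xi, set_val eta) =
    exp_gromov x (set_val xi, set_val eta) * e / (a * b).
  by rewrite -E mulfK// mulf_neq0// gt_eqF.
by field; rewrite !gt_eqF.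
Qed.

Lemma ln_busemann_derivative x x' xi :
  ln (busemann_derivative x x' xi) =
  - mdist x x' - 2 * ln (exp_gromov x (i x', set_val xi)).
Proof.
have a0 : 0 < exp_gromov x (i x', set_val xi) by exact: exp_gromov_incl_gt0.
rewrite /busemann_derivative ln_div ?posrE ?expR_gt0 ?exprn_gt0// expRK lnXn//.
by rewrite mulr_natl.
Qed.

(** The bound is the triangle inequality, and [ray_through] shows that it is
    reached. *)
Lemma sup_busemann_derivative x x' (xi0 : gp_boundary X) :
  sup (range (fun xi => `|ln (busemann_derivative x x' xi)|)) = mdist x x'.
Proof.
have le xi : `|ln (busemann_derivative x x' xi)| <= mdist x x'.
  have a0 : 0 < exp_gromov x (i x', set_val xi) by exact: exp_gromov_incl_gt0.
  have a1 := exp_gromov_le1 x (i x', set_val xi).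
  have := exp_gromov_incl_ge x x' (set_val xi).
  rewrite -{1}[leRHS](@lnK _ (exp_gromov x (i x', set_val xi))) ?posrE// ler_expR => al.
  have := ln_le0 a1; rewrite ln_busemann_derivative ler_norml => ?.
  by apply/andP; split; lra.
apply/eqP; rewrite eq_le; apply/andP; split.
  apply: ge_sup; last by move=> _ [xi _ <-].
  by exists `|ln (busemann_derivative x x' xi0)|, xi0.
have ub : has_ubound (range (fun xi => `|ln (busemann_derivative x x' xi)|)).
  by exists (mdist x x') => _ [xi _ <-].
have [xx'|xx'] := pselect (x = x').
  rewrite -{1}xx' mdistxx.
  by apply: le_trans (ub_le_sup ub (imageT _ xi0)); exact: normr_ge0.
have [xi bxi xie] := ray_through xx'.
apply: ub_le_sup => //; exists (exist _ xi (mem_set bxi)) => //.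
rewrite ln_busemann_derivative set_valE/= xie expRK.
have -> : - mdist x x' - 2 * - mdist x x' = mdist x x' by ring.
by rewrite ger0_norm ?mdist_ge0.
Qed.

Lemma moebius_dist_visual x x' : has_four_points (gp_boundary X) ->
  moebius_dist (@visual R X x) (visual x') = mdist x x'.
Proof.
move=> h4; rewrite /moebius_dist.
rewrite (moebius_derivativeE (visual_separating x) h4 (busemann_derivativeP x x')).
by have [xi0 _] := h4; exact: sup_busemann_derivative.
Qed.

Lemma visual_inj x x' : has_four_points (gp_boundary X) ->
  @visual R X x = visual x' -> x = x'.
Proof.
move=> h4 E; apply: mdist_positivity.
by rewrite -moebius_dist_visual// -E moebius_dist_visual// mdistxx.
Qed.

End Visual.

(** * If the visual embedding is onto, the space is maximal *)
Section BoundaryDetermines.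
Context {R : realType}.
Implicit Types X Y : gromovProductSpace R.

Lemma exp_gromov_diag1 X (x : X) (q : gp_hat X) :
  exp_gromov x (q, q) = 1 -> q = gpc_incl (gp_hat X) x.
Proof.
move=> q1; have [[y _ yq]|bq] := pselect (range (gpc_incl (gp_hat X)) q).
  move: q1; rewrite -yq exp_gromov_self => /(congr1 (@ln R)); rewrite expRK ln1 => /eqP.
  by rewrite oppr_eq0 => /eqP/mdist_positivity ->.
have := (exp_gromov_diag_eq0 x q).2 bq; rewrite q1 => /eqP; by rewrite oner_eq0.
Qed.

(** Apply [cvg_of_separated] with exp(-(q|q)_(F y)), which is 1 only at [F y],
    near a point [y] of [Y], and with the product with [G p], which vanishes
    only at [G p], near a boundary point [p]. *)
Lemma product_preserving_continuous Y X (F : Y -> X) (G : gp_hat Y -> gp_hat X) :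
  (forall y p q, exp_gromov (F y) (G p, G q) = exp_gromov y (p, q)) -> continuous G.
Proof.
move=> GE p; have [y0 _] := gp_inhabited p.
have cpt := @gpc_compact _ _ (gp_hat X).
have [[y _ yp]|bp] := pselect (range (gpc_incl (gp_hat Y)) p).
  apply: (@cvg_of_separated _ R (fun q => exp_gromov (F y) (q, q)) (G p)) => //.
  - exact: exp_gromov_diag_continuous.
  - have -> : exp_gromov (F y) (G p, G p) = 1.
      by rewrite GE -yp exp_gromov_self mdistxx oppr0 expR0.
    move=> q /exp_gromov_diag1 ->; apply/esym/exp_gromov_diag1.
    by rewrite GE -yp exp_gromov_self mdistxx oppr0 expR0.
  - have := @exp_gromov_diag_continuous _ Y y p; rewrite /continuous_at -GE.
    suff -> : (fun q => exp_gromov y (q, q)) = (fun q => exp_gromov (F y) (q, q)) \o G by [].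
    by apply: funext => q /=; rewrite GE.
apply: (@cvg_of_separated _ R (fun q => exp_gromov (F y0) (G p, q)) (G p)) => //.
- exact: exp_gromov_section_continuous.
- have z : exp_gromov (F y0) (G p, G p) = 0 by rewrite GE; exact/exp_gromov_diag_eq0.
  have bGp : gp_boundary X (G p) by exact/(exp_gromov_diag_eq0 (F y0)).
  rewrite z => q; rewrite exp_gromov_sym => q0; apply/(exp_gromov_boundary (F y0)) => //.
  move=> [x _ xq]; have := exp_gromov_incl_gt0 (F y0) x (G p).
  by rewrite xq q0 ltxx.
- have := @exp_gromov_section_continuous _ Y y0 p p; rewrite /continuous_at -GE.
  suff -> : (fun q => exp_gromov y0 (p, q)) = (fun q => exp_gromov (F y0) (G p, q)) \o G by [].
  by apply: funext => q /=; rewrite GE.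
Qed.

End BoundaryDetermines.

(** A map [F] that agrees with [f] on visual functions agrees with it on
    Busemann functions, hence preserves distances and products. *)
Section BoundaryMap.
Context {R : realType} (X Y : gromovProductSpace R).
Variables (f : gp_boundary Y -> gp_boundary X) (F : Y -> X).
Hypotheses (h4 : has_four_points (gp_boundary Y)) (hf : homeomorphism f).
Hypothesis FE : forall y xi eta, visual (F y) (f xi, f eta) = visual y (xi, eta).
Local Notation iX := (gpc_incl (gp_hat X)).
Local Notation iY := (gpc_incl (gp_hat Y)).

Lemma busemann_derivative_map y y' xi :
  busemann_derivative (F y) (F y') (f xi) = busemann_derivative y y' xi.
Proof.
suff E : busemann_derivative (F y) (F y') \o f = busemann_derivative y y'.
  by rewrite -E.
apply: (moebius_derivative_unique (visual_separating y) h4 _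
  (busemann_derivativeP y y')).
have [cD D0 DE] := busemann_derivativeP (F y) (F y').
split=> [|z|a b] /=; first exact: (continuous_compose hf.1 cD).
  exact: D0.
by rewrite -!FE.
Qed.

Lemma visual_map_isometry : distance_preserving F.
Proof.
move=> y y'; have [xi0 _] := h4.
rewrite -(sup_busemann_derivative y y' xi0).
rewrite -(sup_busemann_derivative (F y) (F y') (f xi0)).
congr sup; apply/seteqP; split=> _ [xi _ <-].
  have [_ [g [_ _ gK]]] := hf.
  by exists (g xi) => //; rewrite -busemann_derivative_map gK.
by exists (f xi) => //; rewrite busemann_derivative_map.
Qed.

Lemma exp_gromov_map_mixed y y' (xi : gp_boundary Y) :
  exp_gromov (F y) (iX (F y'), set_val (f xi)) = exp_gromov y (iY y', set_val xi).
Proof.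
have := busemann_derivative_map y y' xi.
rewrite /busemann_derivative visual_map_isometry.
have a0 := exp_gromov_incl_gt0 (F y) (F y') (set_val (f xi)).
have b0 := exp_gromov_incl_gt0 y y' (set_val xi).
move=> /(mulfI _)/invr_inj/eqP; rewrite gt_eqF ?expR_gt0// => /(_ isT).
by rewrite eqrXn2 ?ltW// => /eqP.
Qed.

Definition hat_map (q : gp_hat Y) : gp_hat X :=
  match pselect (range iY q) with
  | left r => iX (F (projT1 (cid2 r)))
  | right b => set_val (f (exist _ q (mem_set b)))
  end.

Lemma hat_map_incl y : hat_map (iY y) = iX (F y).
Proof.
rewrite /hat_map; case: pselect => [r|[]]; last by exists y.
case: cid2 => y' /= _ E; congr (iX (F _)).
by have [inj _ _] := gpc_incl_embedding (gp_hat Y); exact: inj.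
Qed.

Lemma hat_map_boundary xi : hat_map (set_val xi) = set_val (f xi).
Proof.
rewrite /hat_map; case: pselect => [r|b]; first by case: (set_valP xi).
by congr (set_val (f _)); exact: val_inj.
Qed.

Lemma exp_gromov_hat_map y p q : exp_gromov (F y) (hat_map p, hat_map q) = exp_gromov y (p, q).
Proof.
have cases r : (exists z, r = iY z) \/ (exists xi : gp_boundary Y, r = set_val xi).
  have [[z _ <-]|b] := pselect (range iY r); first by left; exists z.
  by right; exists (exist _ r (mem_set b)).
case: (cases p) => [[z ->]|[xi ->]]; case: (cases q) => [[w ->]|[eta ->]].
- rewrite !hat_map_incl !exp_gromov_incl /gromov_product.
  by rewrite !visual_map_isometry.
- by rewrite hat_map_incl hat_map_boundary exp_gromov_map_mixed.
- rewrite hat_map_incl hat_map_boundary exp_gromov_sym exp_gromov_map_mixed.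
  exact: exp_gromov_sym.
- by rewrite !hat_map_boundary -visualE FE.
Qed.

Lemma visual_map_extends : extends_continuously F f.
Proof.
exists hat_map; split; [|exact: hat_map_incl|exact: hat_map_boundary].
exact: (product_preserving_continuous exp_gromov_hat_map).
Qed.

End BoundaryMap.

Lemma visual_isometry_maximal (R : realType) (X : gromovProductSpace R) :
  has_four_points (gp_boundary X) -> visual_isometry X -> maximal X.
Proof.
move=> hX [[_ _ surj] _] Y f hf moeb; have [cf [g [cg fK gK]]] := hf.
have h4 : has_four_points (gp_boundary Y).
  have [a [b [c [d u]]]] := hX; exists (g a), (g b), (g c), (g d).
  by rewrite -(map_inj_uniq (can_inj gK)) in u.
have ginj := can_inj gK.
have [xi0 _] := hX; have [x _] := gp_inhabited (set_val xi0).
have pull y : exists x : X, visual x = (fun p => visual y (g p.1, g p.2)).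
  have [|x' _ x'E] := surj (fun p => visual y (g p.1, g p.2)); last by exists x'.
  exists x => //; split.
    have [[c1 c2 c3 c4] s1 opp] := visual_antipodal y (g xi0).
    split.
    - split.
      + apply: (@continuous_compose _ _ _ (fun p : gp_boundary X * gp_boundary X =>
          (g p.1, g p.2)) (visual y)) => //.
        apply: continuous_pair.
          exact: (continuous_compose (@continuous_fst _ _) cg).
        exact: (continuous_compose (@continuous_snd _ _) cg).
      + by move=> xi eta; exact: c2.
      + by move=> xi eta; exact: c3.
      + by move=> xi eta; rewrite c4; split=> [/ginj|->].
    - rewrite -s1; congr sup; apply/seteqP; split=> _ [[a b] _ <-].
        by exists (g a, g b).
      by exists (f a, f b) => //=; rewrite !fK.
    - move=> xi; have [eta gxe] := opp (g xi); exists (f eta) => /=.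
      by rewrite fK.
  move=> a b c d u; have := moeb y x (g a) (g b) (g c) (g d).
  rewrite !gK => -> //.
  by rewrite -(map_inj_uniq ginj) in u.
have [F FE] := choice pull.
have {}FE y xi eta : visual (F y) (f xi, f eta) = visual y (xi, eta).
  by rewrite FE /= !fK.
exists F; first exact: (visual_map_isometry h4 hf FE).
exact: (visual_map_extends h4 hf FE).
Qed.

(** * A maximal space contains every antipodal function of its boundary *)
Section MaximalIsometry.
Context {R : realType} (X : gromovProductSpace R) (x0 : X) (xi0 : gp_boundary X).

Definition boundary_antipodalSpace : antipodalSpace R :=
  @AntipodalSpace R (gp_boundary X) (visual x0) xi0 (@boundary_compact R X)
    (visual_antipodal x0 xi0).
Local Notation A := boundary_antipodalSpace.
Local Notation Y := (moebiusSpace A).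

(** The logarithm of the derivative, up to sign, is the point of the Moebius
    space that stands for [rho]: the values of [rho] are at most 1 and reach 1
    in every row, which is extremality. *)
Lemma antipodal_extremal rho D : antipodal rho ->
  is_moebius_derivative (visual x0) rho D ->
  extremal (log_kernel (A := A)) (fun xi => - ln (D xi)) /\
  forall xi eta : gp_boundary X, rho (xi, eta) =
    expR (- (- ln (D xi) + - ln (D eta)) / 2) * visual x0 (xi, eta).
Proof.
move=> ap [cD D0 DE]; have [[_ r0 _ _] _ opp] := ap.
have E (xi eta : gp_boundary X) : rho (xi, eta) =
    expR (- (- ln (D xi) + - ln (D eta)) / 2) * visual x0 (xi, eta).
  have e0 := expR_ge0 (- (- ln (D xi) + - ln (D eta)) / 2).
  have v0 : 0 <= visual x0 (xi, eta) by exact: exp_gromov_ge0.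
  apply/eqP; rewrite -(@eqrXn2 _ 2)// ?mulr_ge0// DE exprMn; apply/eqP; congr (_ * _).
  rewrite expr2 -expRD -[D xi in LHS]lnK ?posrE// -[D eta in LHS]lnK ?posrE// -expRD.
  by congr expR; field.
split => //.
have bf : fbounded (fun xi : A => - ln (D xi)).
  have cl : continuous (fun xi : A => `|- ln (D xi)|).
    move=> xi; have cln : (fun xi : A => ln (D xi)) @ xi --> ln (D xi).
      apply: (@continuous_comp A R R D (@ln R)); first exact: cD.
      exact/continuous_ln/D0.
    exact: (cvg_norm (cvgN cln)).
  have [m Hm] := compact_argmax (as_point A) (@as_compact _ A) cl.
  by exists `|- ln (D m)|.
split => //; apply: funext => xi; apply/eqP; rewrite eq_le; apply/andP; split.
  apply: (dual_le (@log_kernel_max R A)) => eta exi.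
  have xe : xi != eta by rewrite eq_sym.
  have := antipodal_le1 (xi, eta) ap; rewrite E.
  rewrite -[visual x0 (xi, eta)](@expR_log_kernel _ A xi eta xe) -expRD expR_le1.
  lra.
have [eta] := opp xi; rewrite E => E1.
have exi : eta != xi.
  apply/eqP => exi; move: E1; rewrite exi (@rhoxx R A xi : visual x0 (xi, xi) = 0).
  rewrite mulr0 => /esym/eqP.
  by rewrite oner_eq0.
have xe : xi != eta by rewrite eq_sym.
have := dual_ge (@log_kernel_le0 R A) bf exi.
move: E1; rewrite -[visual x0 (xi, eta)](@expR_log_kernel _ A xi eta xe) -expRD.
by move=> /(congr1 (@ln R)); rewrite expRK ln1; lra.
Qed.

(** The identification of the boundary of the Moebius space with that of [X];
    the value [xi0] is never taken, as boundary points are not inner. *)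
Definition ideal_point (xi : gp_boundary Y) : gp_boundary X :=
  match (set_val xi : hatMoebius A) with Ideal x => x | Inner _ => xi0 end.

Definition to_ideal (x : gp_boundary X) : gp_boundary Y :=
  exist _ (Ideal (x : A) : gp_hat Y) (mem_set (@Ideal_notin_range R A x)).

Lemma set_val_ideal (xi : gp_boundary Y) :
  set_val xi = Ideal (ideal_point xi : A) :> hatMoebius A.
Proof.
rewrite /ideal_point; have [x E] := notin_range_Inner (set_valP xi).
by rewrite set_valE/= E.
Qed.

Lemma ideal_pointK : cancel ideal_point to_ideal.
Proof. by move=> xi; apply: val_inj => /=; rewrite -set_val_ideal. Qed.

Lemma to_idealK : cancel to_ideal ideal_point.
Proof. by []. Qed.

Lemma ideal_point_homeomorphism : homeomorphism ideal_point.
Proof.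
split; last first.
  exists to_ideal; split; [|exact: ideal_pointK|exact: to_idealK].
  move=> x; apply: (@cvg_set_val (gp_hat Y) _ (to_ideal @ x)).
    exact: (fmap_filter _ (nbhs_filter x)).
  by move=> U nU; exact: (@Ideal_continuous R A x U nU).
move=> xi; apply: (@cvg_of_separated A R (fun x => visual x0 (ideal_point xi, x))).
- exact: (fmap_filter _ (nbhs_filter xi)).
- exact: as_compact.
- exact: (@norm_hausdorff R R).
- exact: (@continuous_section A A R (visual x0) (ideal_point xi) (@rho_continuous R A)).
- move=> x.
  rewrite (@rhoxx R A _ : visual x0 (ideal_point xi, ideal_point xi) = 0).
  by move=> /(@rho_eq0 R A).
- have E (eta : gp_boundary Y) : visual x0 (ideal_point xi, ideal_point eta) =
      hat_prod (set_val xi : hatMoebius A) (set_val eta).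
    by rewrite !set_val_ideal.
  have c : continuous (fun eta : gp_boundary Y =>
      hat_prod (set_val xi : hatMoebius A) (set_val eta)).
    have := @continuous_section _ _ _ _ (set_val xi : hatMoebius A) (@hat_prod_continuous R A).
    exact: (continuous_compose (@set_val_continuous _ (gp_boundary Y))).
  have := c xi; rewrite /continuous_at -E.
  suff -> : (fun eta : gp_boundary Y => hat_prod (set_val xi : hatMoebius A) (set_val eta)) =
    (fun x => visual x0 (ideal_point xi, x)) \o ideal_point by [].
  by apply: funext => eta; rewrite /= E.
Qed.

Lemma visual_moebiusSpace (k : Y) xi eta :
  visual k (xi, eta) =
  expR (- (mp_fun k (ideal_point xi) + mp_fun k (ideal_point eta)) / 2) *
    visual x0 (ideal_point xi, ideal_point eta).
Proof.
rewrite visualE /exp_gromov /= expeR_hat_gp_prod /= !set_val_ideal.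
exact: hat_visual_Ideal.
Qed.

Lemma ideal_point_moebius (y : Y) (x : X) :
  moebius_map (visual y) (visual x) ideal_point.
Proof.
move=> a b c d _.
transitivity (cross_ratio (fun p => visual x0 (ideal_point p.1, ideal_point p.2)) a b c d).
  pose u (xi : gp_boundary Y) := Num.sqrt (busemann_derivative x0 x (ideal_point xi)).
  have [_ D0 DE] := busemann_derivativeP x0 x.
  apply: (@cross_ratio_conformal _ _ _ (fun p => visual x (ideal_point p.1, ideal_point p.2)) u).
    by move=> xi; rewrite sqrtr_gt0; exact: D0.
  move=> xi eta /=; apply/eqP.
  have v z w : 0 <= @visual R X z w by exact: exp_gromov_ge0.
  rewrite -(@eqrXn2 _ 2)// ?mulr_ge0 ?sqrtr_ge0// DE !exprMn.
  by rewrite !sqr_sqrtr// ltW//; exact: D0.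
apply/esym.
apply: (@cross_ratio_conformal _ _ _ _ (fun xi => expR (- mp_fun y (ideal_point xi) / 2))).
  by move=> xi; exact: expR_gt0.
by move=> xi eta; rewrite visual_moebiusSpace -expRD; congr (expR _ * _); field.
Qed.

(** The image of the point that stands for [rho] under the map given by
    maximality has visual function [rho], since that map preserves Gromov
    products, first of inner points and then, by density, of ideal points. *)
Lemma maximal_visual_surjective rho : has_four_points (gp_boundary X) ->
  maximal X -> moebius_space (visual x0) rho -> exists x : X, visual x = rho.
Proof.
move=> h4 maxX [ap equiv].
have hb : hausdorff_space (gp_boundary X).
  move=> a b ab; apply: val_inj; apply: (@gpc_hausdorff _ _ (gp_hat X)) => U V nU nV.
  have [z [Uz Vz]] := ab (set_val @^-1` U) (set_val @^-1` V)
    (@set_val_continuous _ _ a U nU) (@set_val_continuous _ _ b V nV).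
  by exists (set_val z).
have [sp _ _] := ap.
have [D dD] := moebius_derivative_exists hb h4 (visual_separating x0) sp equiv.
have [ef E] := antipodal_extremal ap dD.
pose k : Y := MoebiusPoint ef.
have [F dF [Fhat [cF Fi Fb]]] :=
  maxX Y ideal_point ideal_point_homeomorphism ideal_point_moebius.
exists (F k).
have G : (fun pq => gpc_prod (F k) (Fhat pq.1, Fhat pq.2)) = gpc_prod k.
  apply: (@dense_pair_eq Y (gp_hat Y) _ (gpc_incl (gp_hat Y))).
  - exact: ereal_hausdorff.
  - exact: gpc_incl_dense.
  - apply: (@continuous_compose _ _ _ (fun pq => (Fhat pq.1, Fhat pq.2))).
      apply: continuous_pair.
        exact: (continuous_compose (@continuous_fst _ _) cF).
      exact: (continuous_compose (@continuous_snd _ _) cF).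
    exact: gpc_prod_continuous.
  - exact: gpc_prod_continuous.
  - move=> f g; rewrite -[LHS]/(gpc_prod (F k) (Fhat (gpc_incl (gp_hat Y) f),
      Fhat (gpc_incl (gp_hat Y) g))).
    by rewrite !Fi !gpc_prodE /gromov_product !dF.
apply: funext => -[a b].
rewrite E -[in LHS](to_idealK a) -[in LHS](to_idealK b) visualE -!Fb.
transitivity (visual k (to_ideal a, to_ideal b)).
  by rewrite visualE /exp_gromov -G.
by rewrite visual_moebiusSpace.
Qed.

End MaximalIsometry.

Lemma maximal_visual_isometry (R : realType) (X : gromovProductSpace R) :
  has_four_points (gp_boundary X) -> maximal X -> visual_isometry X.
Proof.
move=> h4 maxX; have [xi0 _] := h4; split; last first.
  by move=> x y; exact: moebius_dist_visual.
split.
- by move=> x _; exists x => //; split; [exact: visual_antipodal|].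
- by move=> x y _ _; exact: visual_inj.
- move=> rho [x0 _ mrho].
  by have [x xE] := maximal_visual_surjective xi0 h4 maxX mrho; exists x.
Qed.

Theorem theorem1p7 (R : realType) (X : gromovProductSpace R)
    (hX : has_four_points (gp_boundary X)) :
  maximal X <-> visual_isometry X.
Proof.
by split; [exact: maximal_visual_isometry|exact: visual_isometry_maximal].
Qed.
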